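(* Let $\mathcal H\colon\mathbb R^{p_1}\times\mathbb R^{p_2}\to\mathbb R^{q_1}$ and $\mathcal G\colon\mathbb R^{p_1}\times\mathbb R^{p_2}\to\mathbb R^{p_2}$ be continuously differentiable, and let $\{z^k\}_{k\in\mathbb N}$ be a sequence generated by the global nonsmooth Levenberg--Marquardt method via the Fischer--Burmeister function described in the context. (a) If the test $\Psi_{\mathrm{FB}}(z^k+d^k)\le\kappa\Psi_{\mathrm{FB}}(z^k)$ in step 2 of the method holds infinitely many times, then $\{\Psi_{\mathrm{FB}}(z^k)\}_{k\in\mathbb N}$ is a null sequence, and each accumulation point of $\{z^k\}_{k\in\mathbb N}$ is a solution of the mixed nonlinear complementarity system $$\mathcal H(w,\xi)=0,\quad \mathcal G(w,\xi)\le0,\quad \xi\ge0,\quad \mathcal G(w,\xi)^\top\xi=0.\qquad(\mathrm{MNLCS})$$ (b) Each accumulation point of $\{z^k\}_{k\in\mathbb N}$ is a stationary point of $\Psi_{\mathrm{FB}}$ (i.e. $\nabla\Psi_{\mathrm{FB}}$ vanishes there). (c) Suppose an accumulation point $\bar z=(\bar w,\bar\xi)$ of $\{z^k\}_{k\in\mathbb N}$ is a solution of (MNLCS) such that for each pair $(a,b)\in\mathbb R^{p_2}\times\mathbb R^{p_2}$ satisfying $$a_i=0,\ b_i=1\ \ (i\in I^-(\bar w,\bar\xi)),\qquad a_i=1,\ b_i=0\ \ (i\in I^+(\bar w,\bar\xi)),\qquad (a_i-1)^2+(b_i-1)^2=1\ \ (i\in I^{00}(\bar w,\bar\xi)),$$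 the matrix $$\begin{bmatrix}\mathcal H'_w(\bar w,\bar\xi)&\mathcal H'_\xi(\bar w,\bar\xi)\\ \widehat{\mathbb D}^a\,\mathcal G'_w(\bar w,\bar\xi)&\widehat{\mathbb D}^a\,\mathcal G'_\xi(\bar w,\bar\xi)-\widehat{\mathbb D}^b\end{bmatrix},$$ where $\widehat{\mathbb D}^a:=\operatorname{diag}(a)\,\mathbb D(I^+(\bar w,\bar\xi)\cup I^{00}(\bar w,\bar\xi))$ and $\widehat{\mathbb D}^b:=\operatorname{diag}(b)\,\mathbb D(I^-(\bar w,\bar\xi)\cup I^{00}(\bar w,\bar\xi))$, possesses linearly independent columns. Then the whole sequence $\{z^k\}_{k\in\mathbb N}$ converges to $\bar z$ superlinearly. If the derivatives of $\mathcal G$ and $\mathcal H$ are locally Lipschitz continuous functions, then the convergence is even quadratic.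
   Context: Norms are Euclidean. $\mathbb I^n$ is the $n\times n$ identity matrix; $\operatorname{diag}(v)$ is the diagonal matrix with diagonal $v$; for $I\subset\{1,\dots,p_2\}$, $\mathbb D(I)\in\mathbb R^{p_2\times p_2}$ is the diagonal matrix with $i$-th diagonal entry $1$ if $i\in I$ and $0$ otherwise. Write $z=(w,\xi)\in\mathbb R^{p_1}\times\mathbb R^{p_2}$, $p:=p_1+p_2$. $\mathcal G_1,\dots,\mathcal G_{p_2}$ are the components of $\mathcal G$; $\mathcal H'_w,\mathcal H'_\xi$, etc. are partial Jacobians. Index sets (with $i\in\{1,\dots,p_2\}$): $I^0(w,\xi)=\{i\mid\mathcal G_i(w,\xi)=0\}$, $I^-(w,\xi)=\{i\mid\mathcal G_i(w,\xi)<0\}$, $I^+(w,\xi)=\{i\in I^0(w,\xi)\mid\xi_i>0\}$, $I^{00}(w,\xi)=\{i\in I^0(w,\xi)\mid\xi_i=0\}$. Residual: $\varphi_{\mathrm{FB}}(a,b):=a+b+\sqrt{a^2+b^2}$ is the Fischer--Burmeister function, $$\mathcal F_{\mathrm{FB}}(w,\xi):=\begin{bmatrix}\mathcal H(w,\xi)\\ \bigl(\varphi_{\mathrm{FB}}(\mathcal G_i(w,\xi),-\xi_i)\bigr)_{i=1}^{p_2}\end{bmatrix},$$ and $\Psi_{\mathrm{FB}}(w,\xi):=\frac12\|\mathcal F_{\mathrm{FB}}(w,\xi)\|^2$, which is continuously differentiable. Define vectors $v_a(w,\xi),v_b(w,\xi)\in\mathbb R^{p_2}$ by $$(v_a)_i:=1+\frac{\mathcal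 G_i(w,\xi)}{\sqrt{\mathcal G_i(w,\xi)^2+\xi_i^2}},\quad (v_b)_i:=1-\frac{\xi_i}{\sqrt{\mathcal G_i(w,\xi)^2+\xi_i^2}}\quad(i\notin I^{00}(w,\xi)),$$ and $(v_a)_i:=(v_b)_i:=1+\frac{\sqrt2}{2}$ for $i\in I^{00}(w,\xi)$, and let $$D_N\mathcal F_{\mathrm{FB}}(w,\xi):=\begin{bmatrix}\mathcal H'_w(w,\xi)&\mathcal H'_\xi(w,\xi)\\ \operatorname{diag}(v_a(w,\xi))\mathcal G'_w(w,\xi)&\operatorname{diag}(v_a(w,\xi))\mathcal G'_\xi(w,\xi)-\operatorname{diag}(v_b(w,\xi))\end{bmatrix}.$$ Global nonsmooth Levenberg--Marquardt method via the Fischer--Burmeister function. Input: starting point $z^0\in\mathbb R^{p_1}\times\mathbb R^{p_2}$, parameters $\kappa\in(0,1)$, $\tau_{\mathrm{abs}}>0$, $\sigma,\beta\in(0,1)$, $\rho>0$, $\gamma_1,\gamma_2>0$. Starting with $k=0$, as long as $\|\mathcal F_{\mathrm{FB}}(z^k)\|\ge\tau_{\mathrm{abs}}$, carry out the following steps and then increase $k$ by one (when $\|\mathcal F_{\mathrm{FB}}(z^k)\|<\tau_{\mathrm{abs}}$, stop and return $z^k$): 1. Set $\nu_k:=\min(\gamma_1,\gamma_2\|\mathcal F_{\mathrm{FB}}(z^k)\|)$ and let $d^k$ be the unique solution $d$ of $\bigl(D_N\mathcal F_{\mathrm{FB}}(z^k)^\top D_N\mathcal F_{\mathrm{FB}}(z^k)+\nu_k\mathbb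 I^p\bigr)d=-\nabla\Psi_{\mathrm{FB}}(z^k)$. 2. If $\Psi_{\mathrm{FB}}(z^k+d^k)\le\kappa\Psi_{\mathrm{FB}}(z^k)$, set $z^{k+1}:=z^k+d^k$. 3. Otherwise: if $\Psi_{\mathrm{FB}}'(z^k)d^k>-\rho\|\nabla\Psi_{\mathrm{FB}}(z^k)\|\|d^k\|$, replace $d^k$ by $-\nabla\Psi_{\mathrm{FB}}(z^k)$. Then set $\alpha_k:=\beta^{i_k}$, where $i_k$ is the smallest positive integer with $\Psi_{\mathrm{FB}}(z^k+\beta^{i_k}d^k)\le\Psi_{\mathrm{FB}}(z^k)+\beta^{i_k}\sigma\Psi_{\mathrm{FB}}'(z^k)d^k$, and set $z^{k+1}:=z^k+\alpha_kd^k$. Convergence $z^k\to\bar z$ is superlinear if $\|z^{k+1}-\bar z\|\in o(\|z^k-\bar z\|)$ and quadratic if $\|z^{k+1}-\bar z\|\in O(\|z^k-\bar z\|^2)$. *)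

(* Defs.v *)
From mathcomp Require Import all_boot all_order all_algebra.
From mathcomp Require Import all_classical all_reals all_analysis.

Set Implicit Arguments.
Unset Strict Implicit.
Unset Printing Implicit Defensive.

Import Order.TTheory GRing.Theory Num.Theory.
Import numFieldNormedType.Exports.

Local Open Scope classical_set_scope.
Local Open Scope ring_scope.

(* A pair z = (w, xi) in R^p1 x R^p2 is the row vector z : 'rV[R]_(p1 + p2) with
   w = lsubmx z and xi = rsubmx z.  The norm `|z| of the library on 'rV[R]_n is
   the sup norm, hence a separate Euclidean norm; both norms induce the topology
   (convergence, cluster points, continuity, differentiability) of 'rV[R]_n. *)
Definition enorm (R : realType) (n : nat) (v : 'rV[R]_n) : R :=
  Num.sqrt (\sum_(j < n) v 0 j ^+ 2).

(* The library's 'J f z acts on row vectors from the right, so that the usual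
   m x n Jacobian matrix is its transpose. *)
Definition Jac (R : realType) (n m : nat) (f : 'rV[R]_n -> 'rV[R]_m)
  (z : 'rV[R]_n) : 'M[R]_(m, n) := ('J f z)^T.

Definition Jac_w (R : realType) (p1 p2 m : nat)
  (f : 'rV[R]_(p1 + p2) -> 'rV[R]_m) (z : 'rV[R]_(p1 + p2)) : 'M[R]_(m, p1) :=
  lsubmx (Jac f z).

Definition Jac_xi (R : realType) (p1 p2 m : nat)
  (f : 'rV[R]_(p1 + p2) -> 'rV[R]_m) (z : 'rV[R]_(p1 + p2)) : 'M[R]_(m, p2) :=
  rsubmx (Jac f z).

Definition continuously_differentiable (R : realType) (n m : nat)
  (f : 'rV[R]_n -> 'rV[R]_m) : Prop :=
  (forall z, differentiable f z) /\ continuous (Jac f).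

(* Lipschitz continuity is with respect to the sup norms on vectors and
   matrices; by equivalence of norms the choice is immaterial here. *)
Definition locally_lipschitz (R : realType) (n m k : nat)
  (f : 'rV[R]_n -> 'M[R]_(m, k)) : Prop :=
  forall z : 'rV[R]_n, exists2 U, nbhs z U & [lipschitz f x | x in U].

Definition grad (R : realType) (n : nat) (f : 'rV[R]_n -> R) (z : 'rV[R]_n) :
  'rV[R]_n := \row_(j < n) 'D_(delta_mx 0 j) f z.

Definition I0 (R : realType) (p1 p2 : nat)
  (G : 'rV[R]_(p1 + p2) -> 'rV[R]_p2) (z : 'rV[R]_(p1 + p2)) : {set 'I_p2} :=
  [set i | G z 0 i == 0]%SET.

Definition Iminus (R : realType) (p1 p2 : nat)
  (G : 'rV[R]_(p1 + p2) -> 'rV[R]_p2) (z : 'rV[R]_(p1 + p2)) : {set 'I_p2} :=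
  [set i | G z 0 i < 0]%SET.

Definition Iplus (R : realType) (p1 p2 : nat)
  (G : 'rV[R]_(p1 + p2) -> 'rV[R]_p2) (z : 'rV[R]_(p1 + p2)) : {set 'I_p2} :=
  [set i in I0 G z | 0 < rsubmx z 0 i]%SET.

Definition I00 (R : realType) (p1 p2 : nat)
  (G : 'rV[R]_(p1 + p2) -> 'rV[R]_p2) (z : 'rV[R]_(p1 + p2)) : {set 'I_p2} :=
  [set i in I0 G z | rsubmx z 0 i == 0]%SET.

Definition Dset (R : realType) (n : nat) (I : {set 'I_n}) : 'M[R]_n :=
  diag_mx (\row_(i < n) (i \in I)%:R).

Definition MNLCS (R : realType) (p1 p2 q1 : nat)
  (H : 'rV[R]_(p1 + p2) -> 'rV[R]_q1) (G : 'rV[R]_(p1 + p2) -> 'rV[R]_p2)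
  (z : 'rV[R]_(p1 + p2)) : Prop :=
  [/\ H z = 0,
      forall i, G z 0 i <= 0,
      forall i, 0 <= rsubmx z 0 i
    & \sum_(i < p2) G z 0 i * rsubmx z 0 i = 0].

Definition phiFB (R : realType) (a b : R) : R :=
  a + b + Num.sqrt (a ^+ 2 + b ^+ 2).

Definition FFB (R : realType) (p1 p2 q1 : nat)
  (H : 'rV[R]_(p1 + p2) -> 'rV[R]_q1) (G : 'rV[R]_(p1 + p2) -> 'rV[R]_p2)
  (z : 'rV[R]_(p1 + p2)) : 'rV[R]_(q1 + p2) :=
  row_mx (H z) (\row_(i < p2) phiFB (G z 0 i) (- rsubmx z 0 i)).

Definition PsiFB (R : realType) (p1 p2 q1 : nat)
  (H : 'rV[R]_(p1 + p2) -> 'rV[R]_q1) (G : 'rV[R]_(p1 + p2) -> 'rV[R]_p2)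
  (z : 'rV[R]_(p1 + p2)) : R :=
  2^-1 * enorm (FFB H G z) ^+ 2.

Definition va (R : realType) (p1 p2 : nat)
  (G : 'rV[R]_(p1 + p2) -> 'rV[R]_p2) (z : 'rV[R]_(p1 + p2)) : 'rV[R]_p2 :=
  \row_(i < p2) if i \in I00 G z then 1 + Num.sqrt 2 / 2
    else 1 + G z 0 i / Num.sqrt (G z 0 i ^+ 2 + rsubmx z 0 i ^+ 2).

Definition vb (R : realType) (p1 p2 : nat)
  (G : 'rV[R]_(p1 + p2) -> 'rV[R]_p2) (z : 'rV[R]_(p1 + p2)) : 'rV[R]_p2 :=
  \row_(i < p2) if i \in I00 G z then 1 + Num.sqrt 2 / 2
    else 1 - rsubmx z 0 i / Num.sqrt (G z 0 i ^+ 2 + rsubmx z 0 i ^+ 2).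

Definition DNFFB (R : realType) (p1 p2 q1 : nat)
  (H : 'rV[R]_(p1 + p2) -> 'rV[R]_q1) (G : 'rV[R]_(p1 + p2) -> 'rV[R]_p2)
  (z : 'rV[R]_(p1 + p2)) : 'M[R]_(q1 + p2, p1 + p2) :=
  block_mx (Jac_w H z) (Jac_xi H z)
           (diag_mx (va G z) *m Jac_w G z)
           (diag_mx (va G z) *m Jac_xi G z - diag_mx (vb G z)).

Definition LM_nu (R : realType) (p1 p2 q1 : nat)
  (H : 'rV[R]_(p1 + p2) -> 'rV[R]_q1) (G : 'rV[R]_(p1 + p2) -> 'rV[R]_p2)
  (gamma1 gamma2 : R) (z : 'rV[R]_(p1 + p2)) : R :=
  Num.min gamma1 (gamma2 * enorm (FFB H G z)).

Definition LM_system (R : realType) (p1 p2 q1 : nat)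
  (H : 'rV[R]_(p1 + p2) -> 'rV[R]_q1) (G : 'rV[R]_(p1 + p2) -> 'rV[R]_p2)
  (gamma1 gamma2 : R) (z d : 'rV[R]_(p1 + p2)) : Prop :=
  ((DNFFB H G z)^T *m DNFFB H G z + (LM_nu H G gamma1 gamma2 z)%:M) *m d^T
  = - (grad (PsiFB H G) z)^T.

Definition LM_direction (R : realType) (p1 p2 q1 : nat)
  (H : 'rV[R]_(p1 + p2) -> 'rV[R]_q1) (G : 'rV[R]_(p1 + p2) -> 'rV[R]_p2)
  (gamma1 gamma2 : R) (z d : 'rV[R]_(p1 + p2)) : Prop :=
  unique (LM_system H G gamma1 gamma2 z) d.

Definition LM_test (R : realType) (p1 p2 q1 : nat)
  (H : 'rV[R]_(p1 + p2) -> 'rV[R]_q1) (G : 'rV[R]_(p1 + p2) -> 'rV[R]_p2)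
  (kappa : R) (z d : 'rV[R]_(p1 + p2)) : bool :=
  PsiFB H G (z + d) <= kappa * PsiFB H G z.

Definition LM_search_direction (R : realType) (p1 p2 q1 : nat)
  (H : 'rV[R]_(p1 + p2) -> 'rV[R]_q1) (G : 'rV[R]_(p1 + p2) -> 'rV[R]_p2)
  (rho : R) (z d : 'rV[R]_(p1 + p2)) : 'rV[R]_(p1 + p2) :=
  if 'd (PsiFB H G) z d > - rho * enorm (grad (PsiFB H G) z) * enorm d
  then - grad (PsiFB H G) z else d.

Definition armijo (R : realType) (p1 p2 q1 : nat)
  (H : 'rV[R]_(p1 + p2) -> 'rV[R]_q1) (G : 'rV[R]_(p1 + p2) -> 'rV[R]_p2)
  (sigma beta : R) (z d : 'rV[R]_(p1 + p2)) (i : nat) : bool :=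
  PsiFB H G (z + beta ^+ i *: d)
    <= PsiFB H G z + beta ^+ i * sigma * 'd (PsiFB H G) z d.

Definition LM_update (R : realType) (p1 p2 q1 : nat)
  (H : 'rV[R]_(p1 + p2) -> 'rV[R]_q1) (G : 'rV[R]_(p1 + p2) -> 'rV[R]_p2)
  (kappa sigma beta rho : R) (z d znext : 'rV[R]_(p1 + p2)) : Prop :=
  if LM_test H G kappa z d then znext = z + d
  else let d' := LM_search_direction H G rho z d in
    exists i : nat,
      [/\ (0 < i)%N, armijo H G sigma beta z d' i,
          forall j, (0 < j)%N -> armijo H G sigma beta z d' j -> (i <= j)%N
        & znext = z + beta ^+ i *: d'].

(* z is the (infinite) sequence of iterates, d k is the direction computed in
   step 1 of iteration k, before any replacement in step 3.  The first conjunct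
   is the negated stopping test.  For tau_abs = 0 the method never stops; this
   case is the one in which the residuals of an infinite run can tend to 0. *)
Definition LM_generated (R : realType) (p1 p2 q1 : nat)
  (H : 'rV[R]_(p1 + p2) -> 'rV[R]_q1) (G : 'rV[R]_(p1 + p2) -> 'rV[R]_p2)
  (kappa tau_abs sigma beta rho gamma1 gamma2 : R)
  (z d : nat -> 'rV[R]_(p1 + p2)) : Prop :=
  forall k : nat,
    [/\ tau_abs <= enorm (FFB H G (z k)),
        LM_direction H G gamma1 gamma2 (z k) (d k)
      & LM_update H G kappa sigma beta rho (z k) (d k) (z k.+1)].

Definition accumulation_point (R : realType) (n : nat)
  (z : nat -> 'rV[R]_n) (zbar : 'rV[R]_n) : Prop :=
  cluster (z @ \oo) zbar.

Definition stationary (R : realType) (n : nat) (f : 'rV[R]_n -> R)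
  (z : 'rV[R]_n) : Prop := grad f z = 0.

Definition admissible_ab (R : realType) (p1 p2 : nat)
  (G : 'rV[R]_(p1 + p2) -> 'rV[R]_p2) (z : 'rV[R]_(p1 + p2))
  (a b : 'rV[R]_p2) : Prop :=
  [/\ forall i, i \in Iminus G z -> a 0 i = 0 /\ b 0 i = 1,
      forall i, i \in Iplus G z -> a 0 i = 1 /\ b 0 i = 0
    & forall i, i \in I00 G z -> (a 0 i - 1) ^+ 2 + (b 0 i - 1) ^+ 2 = 1].

Definition Dhat_a (R : realType) (p1 p2 : nat)
  (G : 'rV[R]_(p1 + p2) -> 'rV[R]_p2) (z : 'rV[R]_(p1 + p2))
  (a : 'rV[R]_p2) : 'M[R]_p2 :=
  diag_mx a *m Dset R (Iplus G z :|: I00 G z)%SET.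

Definition Dhat_b (R : realType) (p1 p2 : nat)
  (G : 'rV[R]_(p1 + p2) -> 'rV[R]_p2) (z : 'rV[R]_(p1 + p2))
  (b : 'rV[R]_p2) : 'M[R]_p2 :=
  diag_mx b *m Dset R (Iminus G z :|: I00 G z)%SET.

Definition qualification_mx (R : realType) (p1 p2 q1 : nat)
  (H : 'rV[R]_(p1 + p2) -> 'rV[R]_q1) (G : 'rV[R]_(p1 + p2) -> 'rV[R]_p2)
  (z : 'rV[R]_(p1 + p2)) (a b : 'rV[R]_p2) : 'M[R]_(q1 + p2, p1 + p2) :=
  block_mx (Jac_w H z) (Jac_xi H z)
           (Dhat_a G z a *m Jac_w G z)
           (Dhat_a G z a *m Jac_xi G z - Dhat_b G z b).

Definition independent_columns (R : realType) (m n : nat) (A : 'M[R]_(m, n)) :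
  bool := row_free A^T.

Definition superlinear_convergence (R : realType) (n : nat)
  (z : nat -> 'rV[R]_n) (zbar : 'rV[R]_n) : Prop :=
  z @ \oo --> zbar /\
  (fun k => enorm (z k.+1 - zbar) : R^o) =o_\oo
    (fun k => enorm (z k - zbar) : R^o).

Definition quadratic_convergence (R : realType) (n : nat)
  (z : nat -> 'rV[R]_n) (zbar : 'rV[R]_n) : Prop :=
  z @ \oo --> zbar /\
  (fun k => enorm (z k.+1 - zbar) : R^o) =O_\oo
    (fun k => enorm (z k - zbar) ^+ 2 : R^o).

(* Main.v *)
(** Every step decreases [Psi], by a factor [kappa] if the test of step 2 holds and by the
    Armijo rule otherwise.  Near a nonstationary point the decrease is bounded below by a
    positive constant, which rules such a point out as an accumulation point.

    The function [phiFB] is nonsmooth at the origin only, where its square still has a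
    Lipschitz gradient; hence [Psi] is continuously differentiable with gradient [F DN].

    At a solution [zbar], positive homogeneity of [phiFB] gives
    [F x - DN x (x - zbar) = o(x - zbar)], and [O] of the square for Lipschitz derivatives.
    The weights [(va x, vb x)] accumulate, as [x] tends to [zbar], only at admissible pairs
    [(a, b)], which form a compact set; so the qualification condition makes [DN x]
    uniformly injective near [zbar].  The full Levenberg-Marquardt step then maps
    [x - zbar] to [o(x - zbar)], passes the test of step 2, and keeps the iterates near
    [zbar] forever once they come close to it. *)
From HB Require Import structures.
Require Import Defs.
From mathcomp Require Import all_boot all_order all_algebra.
From mathcomp Require Import all_classical all_reals all_analysis.
From mathcomp Require Import ring lra.
Set Implicit Arguments.
Unset Strict Implicit.
Unset Printing Implicit Defensive.
Import Order.TTheory GRing.Theory Num.Theory.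
Import numFieldNormedType.Exports.
Local Open Scope classical_set_scope.
Local Open Scope ring_scope.

(** * The Euclidean norm and the Fischer-Burmeister function *)

Section euclidean.
Context {R : realType}.

(** Limits and Taylor estimates are carried out in the sup norm of the library, while testing a
    linear system with a vector calls for the Euclidean inner product; passing between the two norms
    costs the dimension factors such as [n%:R] and [(q1 + p2)%:R + 1] in the constants. The obstacle
    is that [DN] may be discontinuous: at an index of [I00 G zbar] the weights can move around their
    circle without a limit as [x] tends to [zbar], so that no single matrix at [zbar] linearises
    [F]. Expansions of the residual around [zbar] therefore use the weights of the moving point [x].
    For injectivity no subsequence is extracted either: the weights of [x] are compared with a pair
    that keeps them at the indices of [I00 G zbar] and takes the values at [zbar] elsewhere. Such a
    pair is admissible for every [x], so one constant [c], a minimum over all admissible pairs,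
    serves near [zbar]. The estimate of a step uses only [c * enorm v <= enorm (v *m (DN x)^T)] and
    no inverse matrix. *)

Definition dotr (n : nat) (u v : 'rV[R]_n) : R := \sum_(j < n) u 0 j * v 0 j.

Lemma dotrC n (u v : 'rV[R]_n) : dotr u v = dotr v u.
Proof. by apply: eq_bigr => j _; rewrite mulrC. Qed.

Lemma dotrDl n (u v w : 'rV[R]_n) : dotr (u + v) w = dotr u w + dotr v w.
Proof. by rewrite -big_split; apply: eq_bigr => j _; rewrite mxE mulrDl. Qed.

Lemma dotrZl n a (u w : 'rV[R]_n) : dotr (a *: u) w = a * dotr u w.
Proof. by rewrite mulr_sumr; apply: eq_bigr => j _; rewrite mxE mulrA. Qed.

Lemma dotrNl n (u w : 'rV[R]_n) : dotr (- u) w = - dotr u w.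
Proof. by rewrite -scaleN1r dotrZl mulN1r. Qed.

Lemma dotrBl n (u v w : 'rV[R]_n) : dotr (u - v) w = dotr u w - dotr v w.
Proof. by rewrite dotrDl dotrNl. Qed.

Lemma dotrDr n (u v w : 'rV[R]_n) : dotr w (u + v) = dotr w u + dotr w v.
Proof. by rewrite dotrC dotrDl !(dotrC w). Qed.

Lemma dotrZr n a (u w : 'rV[R]_n) : dotr w (a *: u) = a * dotr w u.
Proof. by rewrite dotrC dotrZl dotrC. Qed.

Lemma dotrNr n (u w : 'rV[R]_n) : dotr w (- u) = - dotr w u.
Proof. by rewrite dotrC dotrNl dotrC. Qed.

Lemma dotrE n (u v : 'rV[R]_n) : dotr u v = (u *m v^T) 0 0.
Proof. by rewrite mxE; apply: eq_bigr => j _; rewrite mxE. Qed.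

Lemma dotr_mulmx m n (u : 'rV[R]_m) (v : 'rV[R]_n) (A : 'M[R]_(m, n)) :
  dotr (u *m A) v = dotr u (v *m A^T).
Proof. by rewrite !dotrE trmx_mul trmxK mulmxA. Qed.

Lemma dotr_ge0 n (u : 'rV[R]_n) : 0 <= dotr u u.
Proof. by apply: sumr_ge0 => j _; rewrite -expr2 sqr_ge0. Qed.

Lemma enormE n (u : 'rV[R]_n) : enorm u = Num.sqrt (dotr u u).
Proof. by congr Num.sqrt; apply: eq_bigr => j _; rewrite expr2. Qed.

Lemma enorm_ge0 n (u : 'rV[R]_n) : 0 <= enorm u.
Proof. exact: sqrtr_ge0. Qed.

Lemma enorm_sqr n (u : 'rV[R]_n) : enorm u ^+ 2 = dotr u u.
Proof. by rewrite enormE sqr_sqrtr ?dotr_ge0. Qed.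

Lemma enormZ n a (u : 'rV[R]_n) : enorm (a *: u) = `|a| * enorm u.
Proof.
by rewrite !enormE dotrZl dotrZr mulrA -expr2 sqrtrM ?sqr_ge0// sqrtr_sqr.
Qed.

Lemma enormN n (u : 'rV[R]_n) : enorm (- u) = enorm u.
Proof. by rewrite -scaleN1r enormZ normrN1 mul1r. Qed.

Lemma enorm0 n : enorm (0 : 'rV[R]_n) = 0.
Proof. by rewrite -(scale0r 0) enormZ normr0 mul0r. Qed.

Lemma norm_coord_le m n (A : 'M[R]_(m, n)) i j : `|A i j| <= `|A|.
Proof.
by rewrite {2}/Num.norm/= mx_normrE; apply: (le_bigmax _ (fun k => `|A k.1 k.2|) (i, j)).
Qed.

Lemma norm_mx_le m n (A : 'M[R]_(m, n)) (c : R) :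
  0 <= c -> (forall i j, `|A i j| <= c) -> `|A| <= c.
Proof.
move=> c0 h; rewrite {1}/Num.norm/= mx_normrE; apply/bigmax_leP; split=> // k _; exact: h.
Qed.

Lemma enorm_le n (u : 'rV[R]_n) : enorm u <= n%:R * `|u|.
Proof.
rewrite -(@ler_pXn2r _ 2) ?nnegrE ?enorm_ge0 ?mulr_ge0//.
rewrite enorm_sqr exprMn.
apply: (@le_trans _ _ (\sum_(j < n) `|u| ^+ 2)).
  apply: ler_sum => j _; rewrite -expr2 -[leLHS]real_normK ?num_real//.
  by rewrite lerXn2r ?nnegrE// norm_coord_le.
rewrite sumr_const card_ord -[leLHS]mulr_natl ler_wpM2r ?sqr_ge0//.
by rewrite -natrX ler_nat; case: (n) => // k; rewrite expnS leq_pmulr// expn1.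
Qed.

Lemma norm_le_enorm n (u : 'rV[R]_n) : `|u| <= enorm u.
Proof.
apply: norm_mx_le; first exact: enorm_ge0.
move=> i j; rewrite ord1 -(@ler_pXn2r _ 2) ?nnegrE ?enorm_ge0//.
rewrite real_normK ?num_real// enorm_sqr /dotr (bigD1 j)//= -expr2 lerDl.
by apply: sumr_ge0 => k _; rewrite -expr2 sqr_ge0.
Qed.

Lemma enorm_eq0 n (u : 'rV[R]_n) : enorm u = 0 -> u = 0.
Proof.
by move=> h; apply/eqP; rewrite -normr_le0 -h norm_le_enorm.
Qed.

(** The squared norm of the part of [u] orthogonal to [v], multiplied by [enorm v ^+ 2] to avoid a
    division, equals [b ^+ 2 * ((a * b) ^+ 2 - t ^+ 2)] and is nonnegative. *)
Lemma cauchy_schwarz n (u v : 'rV[R]_n) : dotr u v <= enorm u * enorm v.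
Proof.
have [/enorm_eq0 ->|v0] := eqVneq (enorm v) 0.
  by rewrite enorm0 mulr0 -(scale0r 0) dotrZr mul0r.
have vgt0 : 0 < enorm v by rewrite lt_neqAle eq_sym v0 enorm_ge0.
have [//|h] := leP (dotr u v) (enorm u * enorm v).
have : 0 <= dotr (enorm v ^+ 2 *: u - dotr u v *: v)
                   (enorm v ^+ 2 *: u - dotr u v *: v) by exact: dotr_ge0.
rewrite dotrBl !dotrZl -scaleNr !dotrDr !dotrZr -!enorm_sqr (dotrC v u).
set a := enorm u; set b := enorm v; set t := dotr u v.
have -> : b ^+ 2 * (b ^+ 2 * a ^+ 2 + - t * t) - t * (b ^+ 2 * t + - t * b ^+ 2)
  = b ^+ 2 * ((a * b) ^+ 2 - t ^+ 2) by ring.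
rewrite pmulr_rge0 ?exprn_gt0// subr_ge0 ler_pXn2r ?nnegrE//.
- by rewrite leNgt h.
- by apply: le_trans (ltW h); rewrite mulr_ge0 ?enorm_ge0.
- by rewrite mulr_ge0 ?enorm_ge0.
Qed.

Lemma normr_dotr n (u v : 'rV[R]_n) : `|dotr u v| <= enorm u * enorm v.
Proof.
rewrite ler_norml cauchy_schwarz andbT lerNl -dotrNl -(enormN u).
exact: cauchy_schwarz.
Qed.

Lemma enormD n (u v : 'rV[R]_n) : enorm (u + v) <= enorm u + enorm v.
Proof.
rewrite -(@ler_pXn2r _ 2) ?nnegrE ?addr_ge0 ?enorm_ge0//.
rewrite enorm_sqr dotrDl !dotrDr -!enorm_sqr (dotrC v u).
have := cauchy_schwarz u v; nra.
Qed.

Lemma enormB n (u v : 'rV[R]_n) : enorm (u - v) <= enorm u + enorm v.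
Proof. by rewrite -(enormN v); exact: enormD. Qed.

Lemma enormBl n (u v : 'rV[R]_n) : enorm u - enorm v <= enorm (u - v).
Proof. by rewrite lerBlDr -{1}(subrK v u) enormD. Qed.

Lemma enorm_half n (u v : 'rV[R]_n) :
  enorm (u - v) <= enorm v / 2 -> enorm v / 2 <= enorm u.
Proof.
move=> h; have := enormBl v (v - u).
by rewrite subKr -(enormN (v - u)) opprB; lra.
Qed.

(** Used with [a] and [b] the gradients at two points near [zbar] and [c] the gradient at [zbar]:
    the slopes along [v] differ by little. *)
Lemma dotr_near n (v a b c : 'rV[R]_n) (e : R) :
  enorm (a - c) <= e -> enorm (b - c) <= e ->
  dotr v b <= dotr v a + 2 * e * enorm v.
Proof.
move=> ha hb; rewrite -lerBlDl -dotrNr -dotrDr.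
apply: le_trans (cauchy_schwarz _ _) _; rewrite [leRHS]mulrC ler_wpM2l ?enorm_ge0//.
rewrite -(subrKA c) -[c - a]opprB; apply: le_trans (enormB _ _) _.
by rewrite mulrDl mul1r lerD.
Qed.

Lemma norm_mulmx m n k (v : 'M[R]_(k, m)) (A : 'M[R]_(m, n)) :
  `|v *m A| <= m%:R * `|v| * `|A|.
Proof.
apply: norm_mx_le => [|i j]; first by rewrite !mulr_ge0.
rewrite mxE; apply: le_trans (ler_norm_sum _ _ _) _.
apply: (@le_trans _ _ (\sum_(l < m) `|v| * `|A|)).
  by apply: ler_sum => l _; rewrite normrM ler_pM// norm_coord_le.
by rewrite sumr_const card_ord -[leLHS]mulr_natl mulrA.
Qed.

Lemma norm_trmx m n (A : 'M[R]_(m, n)) : `|A^T| = `|A|.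
Proof.
apply/eqP; rewrite eq_le; apply/andP; split; apply: norm_mx_le => // i j.
  by rewrite mxE norm_coord_le.
by have := norm_coord_le A^T j i; rewrite mxE.
Qed.

End euclidean.

(** * The Fischer-Burmeister function and its weights *)

Section fischer_burmeister.
Context {R : realType}.
Implicit Types a b c d : R.

Definition hyp a b : R := Num.sqrt (a ^+ 2 + b ^+ 2).

(* The weights [va] and [vb] are [FBw a b] and [FBw b a] for [a := G i] and [b := - xi i]. *)
Definition FBw a b : R :=
  if (a == 0) && (b == 0) then 1 + Num.sqrt 2 / 2 else 1 + a / hyp a b.

Lemma hyp_ge0 a b : 0 <= hyp a b. Proof. exact: sqrtr_ge0. Qed.

Lemma hyp_sqr a b : hyp a b ^+ 2 = a ^+ 2 + b ^+ 2.
Proof. by rewrite sqr_sqrtr// addr_ge0 ?sqr_ge0. Qed.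

Lemma hypC a b : hyp a b = hyp b a.
Proof. by rewrite /hyp addrC. Qed.

Lemma hyp00 : hyp 0 0 = 0.
Proof. by rewrite /hyp expr0n addr0 sqrtr0. Qed.

Lemma hyp_gt0 a b : (0 < hyp a b) = ~~ ((a == 0) && (b == 0)).
Proof.
by rewrite sqrtr_gt0 lt_neqAle addr_ge0 ?sqr_ge0// andbT eq_sym
  paddr_eq0 ?sqr_ge0// !sqrf_eq0.
Qed.

Lemma normr_le_hyp a b : `|a| <= hyp a b.
Proof. by rewrite -sqrtr_sqr ler_wsqrtr// lerDl sqr_ge0. Qed.

Lemma hyp_le a b : hyp a b <= `|a| + `|b|.
Proof.
rewrite -(@ler_pXn2r _ 2) ?nnegrE ?hyp_ge0 ?addr_ge0//.
rewrite hyp_sqr -(real_normK (num_real a)) -(real_normK (num_real b)).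
have := normr_ge0 a; have := normr_ge0 b; nra.
Qed.

Lemma hyp_cauchy a b c d : a * c + b * d <= hyp a b * hyp c d.
Proof.
have h0 := hyp_ge0 a b; have h1 := hyp_ge0 c d.
have [//|h] := leP (a * c + b * d) (hyp a b * hyp c d).
have : (hyp a b * hyp c d) ^+ 2 < (a * c + b * d) ^+ 2.
  by rewrite ltr_pXn2r ?nnegrE ?mulr_ge0// ltW// (le_lt_trans _ h)// mulr_ge0.
(* Lagrange's identity: the squares differ by [(a * d - b * c) ^+ 2]. *)
rewrite exprMn !hyp_sqr; have := sqr_ge0 (a * d - b * c); nra.
Qed.

Lemma hypD a b c d : hyp (a + c) (b + d) <= hyp a b + hyp c d.
Proof.
rewrite -(@ler_pXn2r _ 2) ?nnegrE ?addr_ge0 ?hyp_ge0//.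
rewrite hyp_sqr; have := hyp_cauchy a b c d.
by have := hyp_sqr a b; have := hyp_sqr c d; nra.
Qed.

Lemma hypB_le a b c d : `|hyp c d - hyp a b| <= `|c - a| + `|d - b|.
Proof.
have := hypD a b (c - a) (d - b); have := hypD c d (a - c) (b - d).
have := hyp_le (c - a) (d - b); have := hyp_le (a - c) (b - d).
rewrite (distrC a) (distrC b) !(addrC _ (_ - _)) !subrK => *.
by rewrite ler_norml; apply/andP; split; lra.
Qed.

Lemma phiFBE a b : phiFB a b = a + b + hyp a b. Proof. by []. Qed.

Lemma phiFB_eq0 a b : phiFB a b = 0 -> [/\ a <= 0, b <= 0 & a * b = 0].
Proof.
rewrite phiFBE => h; have h0 := normr_le_hyp a b; have h1 := normr_le_hyp b a.
rewrite hypC in h1.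
have ha := ler_norm (- a); have hb := ler_norm (- b); rewrite !normrN in ha hb.
have hE : hyp a b = - (a + b) by lra.
have := hyp_sqr a b; rewrite hE => hs.
by split; [lra|lra|nra].
Qed.

Lemma phiFB_root a b : a <= 0 -> b <= 0 -> a * b = 0 -> phiFB a b = 0.
Proof.
move=> a0 b0 ab; rewrite phiFBE /hyp.
have -> : a ^+ 2 + b ^+ 2 = (a + b) ^+ 2 by rewrite sqrrD ab mul0rn addr0.
by rewrite sqrtr_sqr ler0_norm ?subrr//; lra.
Qed.

Lemma FBw_neq0 a b : 0 < hyp a b -> FBw a b = 1 + a / hyp a b.
Proof. by rewrite hyp_gt0 /FBw => /negbTE ->. Qed.

Lemma FBw_neq0r a b : 0 < hyp a b -> FBw b a = 1 + b / hyp a b.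
Proof. by rewrite hypC => /FBw_neq0. Qed.

(** Off the origin the shifted weights are the unit vector [(a, b) / hyp a b]; at the origin the
    prescribed value gives [(sqrt 2 / 2, sqrt 2 / 2)], a unit vector as well. This is the origin of
    the circle condition on [I00] in [admissible_ab]. *)
Lemma FBw_circle a b : (FBw a b - 1) ^+ 2 + (FBw b a - 1) ^+ 2 = 1.
Proof.
have [h|] := boolP (0 < hyp a b).
  rewrite FBw_neq0// FBw_neq0r// !(addrC 1) !addrK !expr_div_n -mulrDl.
  by rewrite -hyp_sqr divff// expf_neq0// gt_eqF.
rewrite hyp_gt0 negbK => /andP[/eqP-> /eqP->]; rewrite /FBw eqxx/=.
by rewrite !(addrC 1) !addrK expr_div_n sqr_sqrtr//; field.
Qed.

Lemma FBw_bound a b : 0 <= FBw a b <= 2.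
Proof.
have : `|FBw a b - 1| <= 1.
  rewrite -(@expr_le1 _ 2)// real_normK ?num_real//.
  by have := FBw_circle a b; have := sqr_ge0 (FBw b a - 1); lra.
by rewrite ler_norml => /andP[? ?]; apply/andP; split; lra.
Qed.

Lemma FBw_norm a b : `|FBw a b| <= 2.
Proof. by have /andP[h0 h1] := FBw_bound a b; rewrite ger0_norm. Qed.

(** Euler's identity for a positively homogeneous function of degree one, whose partial derivatives
    off the origin are the weights. At the origin both sides vanish, whatever the weights are. *)
Lemma phiFB_homogeneous a b : FBw a b * a + FBw b a * b = phiFB a b.
Proof.
rewrite phiFBE; have [h|] := boolP (0 < hyp a b).
  rewrite FBw_neq0// FBw_neq0r//.
  have -> : (1 + a / hyp a b) * a + (1 + b / hyp a b) * b =
    a + b + (a ^+ 2 + b ^+ 2) / hyp a b by ring.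
  by rewrite -hyp_sqr expr2 mulfK// gt_eqF.
by rewrite hyp_gt0 negbK => /andP[/eqP-> /eqP->]; rewrite hyp00 !mulr0 !addr0.
Qed.

Lemma phiFB_lipschitz a b c d :
  `|phiFB c d - phiFB a b| <= 2 * (`|c - a| + `|d - b|).
Proof.
rewrite !phiFBE.
have -> : c + d + hyp c d - (a + b + hyp a b) =
  (c - a) + (d - b) + (hyp c d - hyp a b) by ring.
have := ler_normD (c - a + (d - b)) (hyp c d - hyp a b).
have := ler_normD (c - a) (d - b); have := hypB_le a b c d; lra.
Qed.

Lemma phiFB_le_hyp a b : `|phiFB a b| <= 3 * hyp a b.
Proof.
rewrite phiFBE; have := normr_le_hyp a b; have := normr_le_hyp b a.
rewrite (hypC b) => h1 h2.
have := ler_normD (a + b) (hyp a b); have := ler_normD a b.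
rewrite (ger0_norm (hyp_ge0 a b)); lra.
Qed.

(** The remainder is exactly the Cauchy-Schwarz defect [hyp c d * hyp a b - (a * c + b * d)] divided
    by [hyp a b], and the defect is at most the squared distance of the two points. The bound
    degenerates at the origin. *)
Lemma phiFB_taylor a b c d : 0 < hyp a b ->
  `|phiFB c d - phiFB a b - (FBw a b * (c - a) + FBw b a * (d - b))|
  <= (`|c - a| + `|d - b|) ^+ 2 / hyp a b.
Proof.
move=> h0; rewrite FBw_neq0// FBw_neq0r// !phiFBE.
have hs := hyp_sqr a b; have hs' := hyp_sqr c d.
have hE : c + d + hyp c d - (a + b + hyp a b) -
    ((1 + a / hyp a b) * (c - a) + (1 + b / hyp a b) * (d - b)) =
    (hyp c d * hyp a b - (a * c + b * d)) / hyp a b.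
  have hn : hyp a b != 0 by rewrite gt_eqF.
  have -> : hyp c d * hyp a b - (a * c + b * d) =
    hyp c d * hyp a b - hyp a b ^+ 2 + (a ^+ 2 + b ^+ 2) - (a * c + b * d).
    by rewrite hs; ring.
  by field.
have hc := hyp_cauchy a b c d.
rewrite hE ger0_norm; last by rewrite divr_ge0 ?hyp_ge0// subr_ge0 [leRHS]mulrC.
rewrite ler_pM2r ?invr_gt0//.
apply: (@le_trans _ _ ((c - a) ^+ 2 + (d - b) ^+ 2)).
  by have := sqr_ge0 (hyp c d - hyp a b); nra.
rewrite -(real_normK (num_real (c - a))) -(real_normK (num_real (d - b))).
have := normr_ge0 (c - a); have := normr_ge0 (d - b); nra.
Qed.

(** Squaring brings in the factor [2 * phiFB a b], of size at most [6 * hyp a b], which cancels the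
    denominator in [phiFB_taylor]; so the estimate is uniform and includes the origin. The constant
    is 6 from this term plus 4 from the squared increment. *)
Lemma sqr_phiFB_taylor a b c d :
  `|phiFB c d ^+ 2 - phiFB a b ^+ 2
    - 2 * phiFB a b * (FBw a b * (c - a) + FBw b a * (d - b))|
  <= 10 * (`|c - a| + `|d - b|) ^+ 2.
Proof.
have N0 : 0 <= `|c - a| + `|d - b| by rewrite addr_ge0.
have hL := phiFB_lipschitz a b c d.
move: N0 hL; set N := `|c - a| + _ => N0 hL.
have hL2 : (phiFB c d - phiFB a b) ^+ 2 <= 4 * N ^+ 2.
  have -> : 4 * N ^+ 2 = (2 * N) ^+ 2 by ring.
  by rewrite -(real_normK (num_real (_ - _))) lerXn2r ?nnegrE//; lra.
set l := FBw a b * _ + _.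
have -> : phiFB c d ^+ 2 - phiFB a b ^+ 2 - 2 * phiFB a b * l =
  2 * phiFB a b * (phiFB c d - phiFB a b - l) + (phiFB c d - phiFB a b) ^+ 2.
  by ring.
have := ler_normD (2 * phiFB a b * (phiFB c d - phiFB a b - l))
  ((phiFB c d - phiFB a b) ^+ 2).
rewrite (ger0_norm (sqr_ge0 _)) !normrM.
suff : `|2| * `|phiFB a b| * `|phiFB c d - phiFB a b - l| <= 6 * N ^+ 2 by lra.
have [h0|] := boolP (0 < hyp a b); last first.
  rewrite hyp_gt0 negbK => /andP[/eqP-> /eqP->].
  by rewrite phiFBE hyp00 !addr0 normr0 mulr0 mul0r mulr_ge0 ?sqr_ge0.
have hT := phiFB_taylor c d h0.
rewrite (ger0_norm (ler0n _ 2)).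
have -> : 6 * N ^+ 2 = (2 * (3 * hyp a b)) * (N ^+ 2 / hyp a b).
  by field; rewrite gt_eqF.
by rewrite ler_pM ?mulr_ge0// ler_pM2l// phiFB_le_hyp.
Qed.

Lemma FBw_continuity a b c d : 0 < hyp a b -> 0 < hyp c d ->
  `|FBw c d - FBw a b| <= 2 * (`|c - a| + `|d - b|) / hyp a b.
Proof.
move=> h0 h1; rewrite !FBw_neq0//.
have -> : 1 + c / hyp c d - (1 + a / hyp a b) =
  ((c - a) - c / hyp c d * (hyp c d - hyp a b)) / hyp a b.
  by field; rewrite !gt_eqF.
rewrite normrM normfV (ger0_norm (hyp_ge0 a b)) ler_pM2r ?invr_gt0//.
apply: le_trans (ler_normB _ _) _; rewrite normrM.
have hc : `|c / hyp c d| <= 1.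
  by rewrite normrM normfV (ger0_norm (hyp_ge0 c d)) ler_pdivrMr// mul1r normr_le_hyp.
have := hypB_le a b c d; have := normr_ge0 (hyp c d - hyp a b).
have := normr_ge0 (d - b); nra.
Qed.

(** The product is a partial derivative of half the square of [phiFB]. The weight alone varies like
    the inverse of [hyp a b], which [phiFB a b] compensates. The constant is 4 from the increment of
    [phiFB] and 6 from that of the weight. *)
Lemma phiFB_w_lipschitz a b c d :
  `|phiFB c d * FBw c d - phiFB a b * FBw a b| <= 10 * (`|c - a| + `|d - b|).
Proof.
have hL := phiFB_lipschitz a b c d.
have -> : phiFB c d * FBw c d - phiFB a b * FBw a b =
  (phiFB c d - phiFB a b) * FBw c d + phiFB a b * (FBw c d - FBw a b) by ring.
apply: le_trans (ler_normD _ _) _; rewrite !normrM.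
have hw := FBw_norm c d; have hw' := FBw_norm a b.
have hd := ler_normB (FBw c d) (FBw a b).
have N0 : 0 <= `|c - a| + `|d - b| by rewrite addr_ge0.
have n0 := normr_ge0 (phiFB c d - phiFB a b).
suff : `|phiFB a b| * `|FBw c d - FBw a b| <= 6 * (`|c - a| + `|d - b|) by nra.
have [h0|] := boolP (0 < hyp a b); last first.
  rewrite hyp_gt0 negbK => /andP[/eqP-> /eqP->].
  by rewrite phiFBE hyp00 !addr0 normr0 mul0r mulr_ge0 ?addr_ge0.
(* If [(c, d)] is the origin, the weight may jump by up to 2, but [phiFB a b] is itself bounded by
   the distance to the origin. *)
have [h1|] := boolP (0 < hyp c d); last first.
  rewrite hyp_gt0 negbK => /andP[/eqP cE /eqP dE].
  have hP : `|phiFB a b| <= 2 * (`|c - a| + `|d - b|).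
    by move: hL; rewrite {1}cE {1}dE {1}phiFBE hyp00 !addr0 sub0r normrN.
  have : `|FBw c d - FBw a b| <= 2.
    have := FBw_bound c d; have := FBw_bound a b.
    by rewrite ler_norml => /andP[? ?] /andP[? ?]; apply/andP; split; lra.
  have := normr_ge0 (FBw c d - FBw a b); have := normr_ge0 (phiFB a b); nra.
have hc := FBw_continuity h0 h1.
have -> : 6 * (`|c - a| + `|d - b|) =
  (3 * hyp a b) * (2 * (`|c - a| + `|d - b|) / hyp a b) by field; rewrite gt_eqF.
by rewrite ler_pM// phiFB_le_hyp.
Qed.

(** The weights are those of the moving point [(a, b)], not of the root. If the root is the origin,
    the residual vanishes identically by homogeneity; otherwise [phiFB_taylor] is centred at
    [(a, b)], which stays away from the origin. *)
Lemma phiFB_newton c d : phiFB c d = 0 -> exists2 K, 0 <= K &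
  exists2 e, 0 < e & forall a b, `|a - c| + `|b - d| < e ->
  `|phiFB a b - (FBw a b * (a - c) + FBw b a * (b - d))|
  <= K * (`|a - c| + `|b - d|) ^+ 2.
Proof.
move=> cd0; have [h0|] := boolP (0 < hyp c d); last first.
  rewrite hyp_gt0 negbK => /andP[/eqP-> /eqP->]; exists 0 => //; exists 1 => //.
  by move=> a b _; rewrite !subr0 phiFB_homogeneous subrr normr0 mul0r.
exists (2 / hyp c d); first by rewrite divr_ge0 ?ltW.
(* Within this radius [hyp a b] is at least half of [hyp c d], whence the constant [2 / hyp c d]. *)
exists (hyp c d / 2); first by rewrite divr_gt0.
move=> a b hN; have hab : hyp c d / 2 <= hyp a b.
  by have := hypB_le c d a b; rewrite ler_norml => /andP[+ _]; lra.
have h1 : 0 < hyp a b by apply: lt_le_trans hab; rewrite divr_gt0.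
have := phiFB_taylor c d h1; rewrite cd0 sub0r -opprD normrN.
have -> : phiFB a b + (FBw a b * (c - a) + FBw b a * (d - b)) =
  phiFB a b - (FBw a b * (a - c) + FBw b a * (b - d)) by ring.
move=> /le_trans; apply; rewrite mulrC (distrC c) (distrC d).
rewrite ler_wpM2r ?sqr_ge0// -[leRHS]invrK lef_pV2 ?posrE ?invr_gt0 ?divr_gt0//.
by rewrite invf_div.
Qed.

End fischer_burmeister.

(** * Differential calculus *)

Section calculus.
Context {R : realType}.

Lemma near_normP (V : normedModType R) (z : V) (P : V -> Prop) :
  (\forall x \near z, P x) <->
  exists2 e : R, 0 < e & forall x, `|x - z| < e -> P x.
Proof.
split=> [/nbhs_normP[e /= e0 h]|[e e0 h]].
  by exists e => // x xz; apply: h; rewrite /= distrC.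
by apply/nbhs_normP; exists e => //= x /=; rewrite distrC; exact: h.
Qed.

Lemma continuous_normP (V W : normedModType R) (f : V -> W) (z : V) :
  {for z, continuous f} <->
  forall e : R, 0 < e -> \forall x \near z, `|f x - f z| < e.
Proof.
split=> [h e e0|h].
  have /cvgrPdist_lt/(_ e e0) : f @ z --> f z by exact: h.
  by apply: filterS => x; rewrite distrC.
apply/cvgrPdist_lt => e e0; move/(_ e e0): h.
by apply: filterS => x; rewrite distrC.
Qed.

(* The little-o of [diff_locallyP] spelled out. *)
Lemma is_diff_eps (V : normedModType R) (f : V -> R) (df : {linear V -> R}) z :
  continuous df ->
  (forall e : R, 0 < e ->
    \forall x \near z, `|f x - f z - df (x - z)| <= e * `|x - z|) ->
  is_diff z f df.
Proof.
move=> dfc h.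
have E : f \o shift z = cst (f z) + df +o_ 0 id.
  apply/eqaddoP => e e0; have /near_normP[d d0 hd] := h e e0.
  apply/near_normP; exists d => // x; rewrite subr0 => xd.
  have := hd (x + z); rewrite addrK => /(_ xd).
  by rewrite /= !fctE /= opprD addrA.
have dE := diff_unique dfc E.
apply: DiffDef => //; apply/diff_locallyP; rewrite dE; split => //.
Qed.

Lemma segment_MVT (V : normedModType R) (f : V -> R) (y v : V) :
  (forall x, differentiable f x) ->
  exists2 t : R, 0 <= t <= 1 & f (y + v) - f y = 'd f (y + t *: v) v.
Proof.
move=> df; pose l (t : R) := y + t *: v.
have dl t : is_diff t l ( *:%R^~ v).
  by apply: (is_diff_eq _ (add0r _)).
have dfl t : is_diff t (f \o l) ('d f (l t) \o ( *:%R^~ v)).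
  have := @dl t; move=> ?; exact: is_diff_comp.
have [||t t01] := @MVT_segment R (f \o l) (fun t => 'd f (l t) v) 0 1 ler01.
- move=> t _; apply: DeriveDef; first by apply: diff_derivable.
  by rewrite deriveE// diff_val/= scale1r.
- apply: continuous_subspaceT => t; apply: differentiable_continuous.
  by apply: ex_diff.
- rewrite /= /l scale1r scale0r addr0 subr0 mulr1 => ->; exists t => //.
Qed.

Lemma diff_Jac n m (f : 'rV[R]_n -> 'rV[R]_m) z v : differentiable f z ->
  'd f z v = v *m (Jac f z)^T.
Proof. by move=> df; rewrite /Jac trmxK /jacobian mul_rV_lin1. Qed.

Lemma is_diff_coord n m (f : 'rV[R]_n -> 'rV[R]_m) z (j : 'I_m) :
  differentiable f z ->
  is_diff z (fun x => f x 0 j : R) (fun v => (v *m (Jac f z)^T) 0 j).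
Proof.
move=> df; have dj := differentiable_coord (f z) 0 j.
have djE : 'd (fun N : 'rV[R]_m => N 0 j : R) (f z) = (fun N : 'rV[R]_m => N 0 j) :> (_ -> R).
  have lin : linear (fun N : 'rV[R]_m => N 0 j : R) by move=> a u v; rewrite !mxE.
  pose isL := GRing.isLinear.Build _ _ _ _ _ lin.
  pose g : {linear 'rV[R]_m -> R} := HB.pack (fun N : 'rV[R]_m => N 0 j) isL.
  exact: (@diff_lin _ _ _ g _ (@coord_continuous _ _ _ 0 j)).
have H1 := differentiable_comp df dj.
apply: DiffDef; first exact: H1.
apply/funext => v; rewrite -diff_Jac//.
by rewrite (diff_comp df dj)/= djE.
Qed.

(** The Jacobian is frozen at a third point [x], so that one lemma serves expansions with the
    derivative at either end of the segment. The mean value theorem is applied coordinate by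
    coordinate, with an intermediate point that depends on the coordinate; hence the bound [w] is
    required on the whole segment. *)
Lemma taylor_bound n m (f : 'rV[R]_n -> 'rV[R]_m) (y z x : 'rV[R]_n) (w : R) :
  (forall x, differentiable f x) ->
  (forall t : R, 0 <= t <= 1 -> `|Jac f (y + t *: (z - y)) - Jac f x| <= w) ->
  `|f z - f y - (z - y) *m (Jac f x)^T| <= n%:R * `|z - y| * w.
Proof.
move=> df hw; have w0 : 0 <= w.
  by apply: le_trans (hw 0 _) => //; rewrite lexx ler01.
apply: norm_mx_le => [|i j]; first by rewrite !mulr_ge0.
rewrite ord1; have dfj u := is_diff_coord j (df u).
have dd u : differentiable (fun v => f v 0 j : R) u by case: (dfj u).
have [t t01] := segment_MVT y (z - y) dd.
rewrite subrKC (@diff_val _ _ _ _ _ _ _ (dfj _)) => E.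
have -> : (f z - f y - (z - y) *m (Jac f x)^T) 0 j =
  ((z - y) *m (Jac f (y + t *: (z - y)) - Jac f x)^T) 0 j.
  by rewrite linearB/= mulmxBr; move: E; rewrite !mxE => ->.
apply: le_trans (norm_coord_le _ _ _) _; apply: le_trans (norm_mulmx _ _) _.
by rewrite norm_trmx ler_wpM2l ?mulr_ge0// hw.
Qed.

Lemma Jac_near n m (f : 'rV[R]_n -> 'rV[R]_m) z e :
  continuously_differentiable f -> 0 < e ->
  exists2 d : R, 0 < d & forall x, `|x - z| < d -> `|Jac f x - Jac f z| < e.
Proof.
by move=> [_ /(_ z) cJ] e0; apply/near_normP; apply: (continuous_normP _ _).1.
Qed.

Lemma Jac_bounded n m (f : 'rV[R]_n -> 'rV[R]_m) z :
  continuously_differentiable f -> exists2 M : R, 0 <= M &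
  exists2 d : R, 0 < d & forall x, `|x - z| < d -> `|Jac f x| <= M.
Proof.
move=> fC; exists (`|Jac f z| + 1); first by rewrite addr_ge0.
have [d d0 hd] := Jac_near z fC ltr01; exists d => // x /hd h.
by rewrite -[Jac f x](subrK (Jac f z)) (le_trans (ler_normD _ _))// addrC lerD2l ltW.
Qed.

Lemma segment_left (V : normedModType R) (y x : V) (t : R) : 0 <= t <= 1 ->
  `|y + t *: (x - y) - y| <= `|x - y|.
Proof.
by move=> /andP[t0 t1]; rewrite addrC addKr normrZ ger0_norm// ler_piMl.
Qed.

Lemma segment_right (V : normedModType R) (y x : V) (t : R) : 0 <= t <= 1 ->
  `|y + t *: (x - y) - x| <= `|x - y|.
Proof.
move=> /andP[t0 t1].
have -> : y + t *: (x - y) - x = (t - 1) *: (x - y).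
  by rewrite scalerBl scale1r opprB addrAC addrC addrA addrAC.
by rewrite normrZ ler0_norm ?subr_le0// ler_piMl// opprB lerBlDr lerDl.
Qed.

Lemma taylor_base n m (f : 'rV[R]_n -> 'rV[R]_m) z e :
  continuously_differentiable f -> 0 < e -> exists2 d : R, 0 < d &
  forall x, `|x - z| < d ->
    `|f x - f z - (x - z) *m (Jac f z)^T| <= e * `|x - z|.
Proof.
move=> fC e0; have e1 : 0 < e / (n%:R + 1) by rewrite divr_gt0.
have [d d0 hd] := Jac_near z fC e1; exists d => // x xd.
apply: le_trans (taylor_bound (w := e / (n%:R + 1)) fC.1 _) _.
  move=> t t01; apply/ltW/hd; apply: le_lt_trans xd; exact: segment_left.
rewrite mulrAC ler_wpM2r// mulrC mulrAC ler_pdivrMr ?ltr_wpDl// ler_pM2l//.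
by rewrite lerDl.
Qed.

Lemma taylor_moving n m (f : 'rV[R]_n -> 'rV[R]_m) z e :
  continuously_differentiable f -> 0 < e -> exists2 d : R, 0 < d &
  forall x, `|x - z| < d ->
    `|f x - f z - (x - z) *m (Jac f x)^T| <= e * `|x - z|.
Proof.
(* Both the segment point and [x] are compared with [z], each for half of the tolerance. *)
move=> fC e0; have e1 : 0 < e / (n%:R + 1) / 2 by rewrite !divr_gt0.
have [d d0 hd] := Jac_near z fC e1; exists d => // x xd.
apply: le_trans (taylor_bound (w := e / (n%:R + 1)) fC.1 _) _.
  move=> t t01; rewrite -[X in `|X|](subrKA (Jac f z)).
  apply: le_trans (ler_normD _ _) _; rewrite [leRHS]splitr lerD//; apply/ltW.
    by apply/hd; apply: le_lt_trans xd; exact: segment_left.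
  by rewrite distrC hd.
rewrite mulrAC ler_wpM2r// mulrC mulrAC ler_pdivrMr ?ltr_wpDl// ler_pM2l//.
by rewrite lerDl.
Qed.

Lemma taylor_lipschitz n m (f : 'rV[R]_n -> 'rV[R]_m) z :
  continuously_differentiable f -> locally_lipschitz (Jac f) ->
  exists2 K : R, 0 <= K & exists2 d : R, 0 < d &
  forall x, `|x - z| < d ->
    `|f x - f z - (x - z) *m (Jac f x)^T| <= K * `|x - z| ^+ 2.
Proof.
move=> fC /(_ z)[U /near_normP[d d0 dU] [L [Lr hL]]].
(* The Lipschitz estimate is available for every constant above [L]; this one is also
   nonnegative. *)
have {}hL := hL (Num.max L 0 + 1).
have L0 : 0 <= Num.max L 0 + 1 by rewrite addr_ge0// le_max lexx orbT.
have /hL {}hL : L < Num.max L 0 + 1 by rewrite ltr_pwDr// le_max lexx.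
move: L0 hL; set L' := Num.max L 0 + 1 => L0 hL.
exists (n%:R * L'); first by rewrite mulr_ge0.
exists d => // x xd.
apply: le_trans (taylor_bound (w := L' * `|x - z|) fC.1 _) _.
  move=> t t01; have := hL (z + t *: (x - z), x) => /=.
  move=> /(_ _)/le_trans; apply.
    by split; apply: dU => //; apply: le_lt_trans xd; exact: segment_left.
  by rewrite ler_wpM2l//; exact: segment_right.
by rewrite expr2 -!mulrA ler_wpM2l// mulrCA.
Qed.

Lemma C1_calm n m (f : 'rV[R]_n -> 'rV[R]_m) z :
  continuously_differentiable f ->
  exists2 K : R, 0 <= K & exists2 d : R, 0 < d &
  forall x, `|x - z| < d -> `|f x - f z| <= K * `|x - z|.
Proof.
move=> fC; have [d d0 hd] := taylor_base z fC ltr01.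
exists (n%:R * `|Jac f z| + 1); first by rewrite addr_ge0// mulr_ge0.
exists d => // x /hd h.
rewrite -[f x - f z](subrK ((x - z) *m (Jac f z)^T)).
apply: le_trans (ler_normD _ _) _; rewrite mulrDl addrC lerD//.
by apply: le_trans (norm_mulmx _ _) _; rewrite norm_trmx mulrAC.
Qed.

Lemma C1_continuous n m (f : 'rV[R]_n -> 'rV[R]_m) :
  continuously_differentiable f -> continuous f.
Proof. by move=> [df _] x; exact: differentiable_continuous. Qed.

Lemma mx_continuous (T : topologicalType) m n (f : T -> 'M[R]_(m, n)) z :
  (forall i j, {for z, continuous (fun x => f x i j)}) -> {for z, continuous f}.
Proof.
move=> h; apply/cvg_ballP => e e0.
have hij (k : 'I_m * 'I_n) : \forall x \near z, ball (f z k.1 k.2) e (f x k.1 k.2).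
  by have /cvg_ballP := h k.1 k.2; exact.
near=> x; split=> // i j.
have : forall k : 'I_m * 'I_n, ball (f z k.1 k.2) e (f x k.1 k.2).
  by near: x; exact: (filter_forall _ hij).
by move/(_ (i, j)).
Unshelve. all: by end_near. Qed.

Lemma coord_continuous_for (T : topologicalType) m n (f : T -> 'M[R]_(m, n)) z i j :
  {for z, continuous f} -> {for z, continuous (fun x => f x i j : R)}.
Proof.
by move=> fz; apply: (@continuous_comp _ _ _ f (fun M => M i j)) => //;
  exact: coord_continuous.
Qed.

Lemma sum_continuous (T : topologicalType) (I : Type) (r : seq I) (P : pred I)
  (f : I -> T -> R) z : (forall i, P i -> {for z, continuous (f i)}) ->
  {for z, continuous (fun x => \sum_(i <- r | P i) f i x)}.
Proof.
move=> h; elim: r => [|i r IH].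
  have -> : (fun x => \sum_(i <- [::] | P i) f i x) = cst 0.
    by apply/funext => x; rewrite big_nil.
  exact: cvg_cst.
have -> : (fun x => \sum_(j <- i :: r | P j) f j x) =
  (fun x => (if P i then f i x else 0) + \sum_(j <- r | P j) f j x).
  by apply/funext => x; rewrite big_cons; case: ifP => // _; rewrite add0r.
apply: continuousD => //; case Pi: (P i); [exact: h|exact: cvg_cst].
Qed.

Lemma mulmx_continuous (T : topologicalType) k m n (f : T -> 'M[R]_(k, m))
  (g : T -> 'M[R]_(m, n)) z :
  {for z, continuous f} -> {for z, continuous g} ->
  {for z, continuous (fun x => f x *m g x)}.
Proof.
move=> cf cg; apply: mx_continuous => i j.
have -> : (fun x => (f x *m g x) i j) = (fun x => \sum_l f x i l * g x l j).
  by apply/funext => x; rewrite mxE.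
by apply: sum_continuous => l _; apply: continuousM; exact: coord_continuous_for.
Qed.

End calculus.

(** * The merit function *)

Section linearization.
Context {R : realType} {p1 p2 q1 : nat}.
Local Notation p := (p1 + p2)%N.

(* The action [v |-> D v] of the block matrices of the statement, on row vectors. *)
Definition FBlin (JH : 'M[R]_(q1, p)) (JG : 'M[R]_(p2, p)) (a b : 'rV[R]_p2)
  (v : 'rV[R]_p) : 'rV[R]_(q1 + p2) :=
  row_mx (v *m JH^T) (\row_i (a 0 i * (v *m JG^T) 0 i - b 0 i * rsubmx v 0 i)).

Lemma FBlinEr JH JG a b v i : FBlin JH JG a b v 0 (rshift q1 i) =
  a 0 i * (v *m JG^T) 0 i - b 0 i * rsubmx v 0 i.
Proof. by rewrite row_mxEr mxE. Qed.

Lemma FBlinEl JH JG a b v i :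
  FBlin JH JG a b v 0 (lshift p2 i) = (v *m JH^T) 0 i.
Proof. exact: row_mxEl. Qed.

Lemma mulmx_block_tr (JH : 'M[R]_(q1, p)) (JG : 'M[R]_(p2, p)) a b v :
  v *m (block_mx (lsubmx JH) (rsubmx JH) (diag_mx a *m lsubmx JG)
     (diag_mx a *m rsubmx JG - diag_mx b))^T = FBlin JH JG a b v.
Proof.
rewrite tr_block_mx -{1}(hsubmxK v) mul_row_block; congr row_mx.
  by rewrite -[in RHS](hsubmxK v) -[in RHS](hsubmxK JH) tr_row_mx mul_row_col.
rewrite linearB/= !trmx_mul !tr_diag_mx mulmxBr !mulmxA addrA -mulmxDl.
rewrite -mul_row_col -tr_row_mx !hsubmxK.
by apply/rowP => i; rewrite !mul_mx_diag !mxE mulrC [b 0 i * _]mulrC.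
Qed.

Lemma norm_FBlin JH JG a b v : `|FBlin JH JG a b v| <=
  (p%:R * `|JH| + p%:R * `|JG| * `|a| + `|b|) * `|v|.
Proof.
apply: norm_mx_le => [|i j]; first by rewrite mulr_ge0// !addr_ge0// !mulr_ge0.
rewrite mxE; case: fintype.split => k.
  apply: le_trans (norm_coord_le _ _ _) _; apply: le_trans (norm_mulmx _ _) _.
  by rewrite norm_trmx mulrAC ler_wpM2r// -addrA lerDl addr_ge0 ?mulr_ge0.
rewrite mxE; apply: le_trans (ler_normB _ _) _; rewrite !normrM.
rewrite -addrA mulrDl ler_wpDl ?mulr_ge0// mulrDl lerD//.
  have -> : p%:R * `|JG| * `|a| * `|v| = `|a| * (p%:R * `|v| * `|JG|) by ring.
  rewrite ler_pM ?norm_coord_le//; apply: le_trans (norm_coord_le _ _ _) _.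
  by rewrite -[`|JG|]norm_trmx norm_mulmx.
by rewrite ler_pM// ?norm_coord_le// mxE norm_coord_le.
Qed.

(** Telescoping in an order that leaves only the weights [a] of the first matrix, always at most 2
    in the applications, and the Jacobian [JG'] of the second one, fixed at [zbar]. *)
Lemma FBlinB JH JG a b JH' JG' a' b' v :
  FBlin JH JG a b v - FBlin JH' JG' a' b' v =
  FBlin (JH - JH') (JG - JG') a 0 v + FBlin 0 JG' (a - a') (b - b') v.
Proof.
apply/rowP => j; rewrite !mxE; case: fintype.split => k.
  by rewrite trmx0 mulmx0 linearB/= mulmxBr !mxE addr0.
by rewrite linearB/= mulmxBr !mxE; ring.
Qed.

Lemma norm_FBlinB JH JG a b JH' JG' a' b' v :
  `|FBlin JH JG a b v - FBlin JH' JG' a' b' v| <=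
  (p%:R * `|JH - JH'| + p%:R * `|JG - JG'| * `|a| +
   p%:R * `|JG'| * `|a - a'| + `|b - b'|) * `|v|.
Proof.
rewrite FBlinB; apply: le_trans (ler_normD _ _) _.
apply: le_trans (lerD (norm_FBlin _ _ _ _ _) (norm_FBlin _ _ _ _ _)) _.
by rewrite !normr0 mulr0 add0r addr0 -mulrDl !addrA.
Qed.

End linearization.

(** * The residual and the differentiability of the merit function *)

Section merit_function.
Context {R : realType} {p1 p2 q1 : nat}.
Variables (H : 'rV[R]_(p1 + p2) -> 'rV[R]_q1) (G : 'rV[R]_(p1 + p2) -> 'rV[R]_p2).
Local Notation p := (p1 + p2)%N.
Local Notation F := (FFB H G).
Local Notation DN := (DNFFB H G).
Local Notation Psi := (PsiFB H G).
Local Notation xi := rsubmx.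

Lemma vaE z i : va G z 0 i = FBw (G z 0 i) (- xi z 0 i).
Proof. by rewrite mxE /FBw !inE oppr_eq0 /hyp sqrrN. Qed.

Lemma vbE z i : vb G z 0 i = FBw (- xi z 0 i) (G z 0 i).
Proof.
rewrite mxE /FBw !inE oppr_eq0 /hyp sqrrN andbC (addrC (xi z 0 i ^+ 2)).
by rewrite mulNr.
Qed.

Lemma norm_va z : `|va G z| <= 2.
Proof. by apply: norm_mx_le => // i j; rewrite ord1 vaE FBw_norm. Qed.

Lemma norm_vb z : `|vb G z| <= 2.
Proof. by apply: norm_mx_le => // i j; rewrite ord1 vbE FBw_norm. Qed.

Lemma mulmx_DN z v : v *m (DN z)^T = FBlin (Jac H z) (Jac G z) (va G z) (vb G z) v.
Proof. exact: mulmx_block_tr. Qed.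

Lemma FFBr z i : F z 0 (rshift q1 i) = phiFB (G z 0 i) (- xi z 0 i).
Proof. by rewrite row_mxEr mxE. Qed.

Lemma FFBl z i : F z 0 (lshift p2 i) = H z 0 i.
Proof. by rewrite row_mxEl. Qed.

Lemma PsiE z : Psi z = 2^-1 * dotr (F z) (F z).
Proof. by rewrite /PsiFB enorm_sqr. Qed.

Lemma Psi_ge0 z : 0 <= Psi z.
Proof. by rewrite PsiE mulr_ge0// dotr_ge0. Qed.

Lemma FB_args_le x z i :
  `|G x 0 i - G z 0 i| + `|- xi x 0 i - - xi z 0 i| <= `|G x - G z| + `|x - z|.
Proof.
apply: lerD; first by have := norm_coord_le (G x - G z) 0 i; rewrite !mxE.
rewrite -opprD normrN.
by have := norm_coord_le (x - z) 0 (rshift p1 i); rewrite !mxE.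
Qed.

Lemma Psi_eq0 z : Psi z = 0 -> F z = 0.
Proof.
rewrite PsiE => /eqP; rewrite mulf_eq0 invr_eq0 pnatr_eq0/= => /eqP h.
by apply: enorm_eq0; rewrite enormE h sqrtr0.
Qed.

Lemma FFB_eq0 z : F z = 0 <-> MNLCS H G z.
Proof.
split=> [F0|[H0 G0 x0 Gx]].
  have h i : phiFB (G z 0 i) (- xi z 0 i) = 0 by rewrite -FFBr F0 mxE.
  split.
  - by apply/rowP => i; rewrite -FFBl F0 !mxE.
  - by move=> i; have [] := phiFB_eq0 (h i).
  - by move=> i; have [_ + _] := phiFB_eq0 (h i); rewrite oppr_le0.
  - rewrite big1// => i _; have [_ _] := phiFB_eq0 (h i).
    by rewrite mulrN => /eqP; rewrite oppr_eq0 => /eqP.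
apply/rowP => j; rewrite !mxE; case: fintype.split => i; first by rewrite H0 mxE.
rewrite mxE phiFB_root ?oppr_le0// mulrN.
(* Complementarity is given as a vanishing sum; by the sign conditions all its terms have one sign,
   so each is zero. *)
have /psumr_eq0P h : forall i, true -> 0 <= - (G z 0 i * xi z 0 i).
  by move=> k _; rewrite oppr_ge0 mulr_le0_ge0.
by apply: h => //; rewrite sumrN Gx oppr0.
Qed.

Hypothesis HC : continuously_differentiable H.
Hypothesis GC : continuously_differentiable G.

Lemma FFB_calm z : exists2 K : R, 0 <= K & exists2 d : R, 0 < d &
  forall x, `|x - z| < d -> `|F x - F z| <= K * `|x - z|.
Proof.
have [K K0 [d d0 hK]] := C1_calm z HC; have [L L0 [e e0 hL]] := C1_calm z GC.
exists (K + 2 * (L + 1)); first by rewrite addr_ge0// mulr_ge0// addr_ge0.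
exists (Num.min d e); first by rewrite lt_min d0.
move=> x; rewrite lt_min => /andP[/hK {}hK /hL {}hL].
have n0 := normr_ge0 (x - z).
apply: norm_mx_le => [|i j]; first by rewrite mulr_ge0// addr_ge0// mulr_ge0// addr_ge0.
rewrite ord1 -[j]splitK; case: (fintype.split j) => k /=; rewrite mxE [X in _ + X]mxE.
  rewrite !FFBl; have := norm_coord_le (H x - H z) 0 k; rewrite !mxE.
  by nra.
rewrite !FFBr; have := FB_args_le x z k.
by have := phiFB_lipschitz (G z 0 k) (- xi z 0 k) (G x 0 k) (- xi x 0 k); nra.
Qed.

(** The weights are bounded by 2 everywhere, so local bounds on the two Jacobians suffice even where
    [DN] jumps. *)
Lemma DN_bounded z : exists2 M : R, 0 <= M & exists2 d : R, 0 < d &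
  forall x v, `|x - z| < d -> enorm (v *m (DN x)^T) <= M * enorm v.
Proof.
have [K K0 [d d0 hK]] := Jac_bounded z HC; have [L L0 [e e0 hL]] := Jac_bounded z GC.
exists ((q1 + p2)%:R * (p%:R * K + p%:R * L * 2 + 2)).
  by rewrite mulr_ge0// !addr_ge0 ?mulr_ge0.
exists (Num.min d e); first by rewrite lt_min d0.
move=> x v; rewrite lt_min => /andP[/hK {}hK /hL {}hL].
apply: le_trans (enorm_le _) _; rewrite -mulrA ler_wpM2l// mulmx_DN.
apply: le_trans (norm_FBlin _ _ _ _ _) _.
rewrite ler_pM ?norm_le_enorm// ?addr_ge0 ?mulr_ge0//.
by rewrite !lerD ?norm_vb// ?ler_pM ?mulr_ge0 ?norm_va// ler_pM.
Qed.

(** Absorbs quadratic terms and terms of the form [e * |x - z|] at once. The constant [C] must not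
    depend on [e]; both the radius and the inner tolerance are taken as [e / (2 * (C + 1))]. *)
Lemma littleo_intro (V : normedModType R) (A : V -> R) (z : V) (C : R) : 0 <= C ->
  (forall e, 0 < e -> exists2 d : R, 0 < d & forall x, `|x - z| < d ->
     `|A x| <= C * (`|x - z| + e) * `|x - z|) ->
  forall e, 0 < e -> exists2 d : R, 0 < d & forall x, `|x - z| < d ->
     `|A x| <= e * `|x - z|.
Proof.
move=> C0 h e e0; have e1 : 0 < e / (2 * (C + 1)).
  by rewrite divr_gt0// mulr_gt0// ltr_wpDl.
have [d d0 hd] := h _ e1; exists (Num.min d (e / (2 * (C + 1)))).
  by rewrite lt_min d0.
move=> x; rewrite lt_min => /andP[/hd {}hd he].
apply: le_trans hd _; rewrite ler_wpM2r//.
apply: (@le_trans _ _ (C * (e / (2 * (C + 1)) * 2))).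
  by rewrite ler_wpM2l//; lra.
have -> : C * (e / (2 * (C + 1)) * 2) = C / (C + 1) * e.
  by field; rewrite gt_eqF// ltr_wpDl.
apply: ler_piMl; first exact: ltW.
by rewrite ler_pdivrMr ?mul1r ?lerDl// ltr_wpDl.
Qed.

Lemma dotr_linear n (w : 'rV[R]_n) : linear (fun v => dotr v w).
Proof. by move=> a u v; rewrite dotrDl dotrZl. Qed.

Lemma dotr_continuous n (w : 'rV[R]_n) : continuous (fun v => dotr v w).
Proof.
move=> z; apply/continuous_normP => e e0; apply/near_normP.
exists (e / (n%:R * enorm w + 1)).
  by rewrite divr_gt0// ltr_wpDl// mulr_ge0// enorm_ge0.
move=> x; rewrite ltr_pdivlMr ?ltr_wpDl ?mulr_ge0 ?enorm_ge0// -dotrBl.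
move=> h; apply: le_lt_trans (normr_dotr _ _) _; apply: le_lt_trans h.
rewrite mulrDr mulr1 ler_wpDr// mulrCA mulrA ler_wpM2r ?enorm_ge0//.
exact: enorm_le.
Qed.

(** The squares of the components of [F] are expanded one by one. For a Fischer-Burmeister component
    [sqr_phiFB_taylor] is linear in the increment of [G], and replacing that increment by its linear
    part costs a bounded weight times the Taylor error of [G]. *)
Lemma Psi_is_diff z : is_diff z Psi (fun v => dotr v (F z *m DN z)).
Proof.
pose isL := GRing.isLinear.Build _ _ _ _ _ (dotr_linear (F z *m DN z)).
pose df : {linear 'rV[R]_p -> R} :=
  HB.pack (fun v : 'rV[R]_p => dotr v (F z *m DN z)) isL.
suff : is_diff z Psi df by [].
apply: is_diff_eps; first exact: dotr_continuous.
move=> e e0; apply/near_normP; move: e e0.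
have [K K0 [d d0 hK]] := C1_calm z HC; have [L L0 [d' d'0 hL]] := C1_calm z GC.
(* The summands bound the squared increments of [H], the error in [sqr_phiFB_taylor] for arguments
   that move by [(L + 1) * |x - z|], and the linearisation error times [2 * |F z|] and a weight of
   at most 2. *)
pose C := K ^+ 2 + 10 * (L + 1) ^+ 2 + 4 * `|F z|.
have k2 := sqr_ge0 K; have l2 := sqr_ge0 (L + 1).
have C0 : 0 <= C.
  by rewrite /C; have := normr_ge0 (F z); lra.
apply: (@littleo_intro _ _ _ ((q1 + p2)%:R * C)); first by rewrite mulr_ge0.
move=> e e0; have [d1 d10 h1] := taylor_base z HC e0.
have [d2 d20 h2] := taylor_base z GC e0.
exists (Num.min (Num.min d d') (Num.min d1 d2)); first by rewrite !lt_min d0 d'0 d10.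
move=> x; rewrite !lt_min => /andP[/andP[/hK {}hK /hL {}hL] /andP[/h1 {}h1 /h2 {}h2]].
set l := (x - z) *m (DN z)^T.
have n0 := normr_ge0 (x - z).
have F0 := normr_ge0 (F z).
have term k : `|F x 0 k ^+ 2 - F z 0 k ^+ 2 - 2 * F z 0 k * l 0 k| <=
    C * (`|x - z| + e) * `|x - z|.
  have hF := norm_coord_le (F z) 0 k; move: hF.
  rewrite /l mulmx_DN -[k]splitK; case: (fintype.split k) => i /=.
    rewrite !FFBl row_mxEl => hF.
    set m := (_ *m _) 0 i.
    have -> : H x 0 i ^+ 2 - H z 0 i ^+ 2 - 2 * H z 0 i * m =
      (H x 0 i - H z 0 i) ^+ 2 + 2 * H z 0 i * (H x 0 i - H z 0 i - m) by ring.
    apply: le_trans (ler_normD _ _) _; rewrite normrX !normrM (ger0_norm (ler0n _ 2)).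
    have a1 : `|H x 0 i - H z 0 i| ^+ 2 <= K ^+ 2 * `|x - z| ^+ 2.
      rewrite -exprMn lerXn2r ?nnegrE ?mulr_ge0//; apply: le_trans hK.
      by have := norm_coord_le (H x - H z) 0 i; rewrite !mxE.
    have a2 : `|H x 0 i - H z 0 i - m| <= e * `|x - z|.
      apply: le_trans h1; have := norm_coord_le (H x - H z - (x - z) *m (Jac H z)^T) 0 i.
      by rewrite /m !mxE.
    have a3 : `|H z 0 i| * `|H x 0 i - H z 0 i - m| <= `|F z| * (e * `|x - z|).
      by rewrite ler_pM.
    have a4 : 0 <= `|F z| * (e * `|x - z|) by rewrite !mulr_ge0// ltW.
    have a5 : 0 <= `|F z| * `|x - z| ^+ 2 by rewrite mulr_ge0 ?sqr_ge0.
    have a6 : 0 <= (K ^+ 2 + 10 * (L + 1) ^+ 2) * (e * `|x - z|).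
      by apply: mulr_ge0; [lra|rewrite mulr_ge0// ltW].
    have a7 : 0 <= (L + 1) ^+ 2 * `|x - z| ^+ 2 by rewrite mulr_ge0 ?sqr_ge0.
    rewrite /C; clear -a1 a3 a4 a5 a6 a7; nra.
  rewrite !FFBr row_mxEr [X in _ * X]mxE vaE vbE => hF.
  set m := (_ *m _) 0 i; set w := FBw _ _; set w' := FBw _ _.
  have -> : rsubmx (x - z) 0 i = - (- xi x 0 i - - xi z 0 i) by rewrite !mxE; ring.
  set P := phiFB (G x 0 i) _; set Q := phiFB (G z 0 i) _; set t := _ - - _.
  have -> : P ^+ 2 - Q ^+ 2 - 2 * Q * (w * m - w' * - t) =
    (P ^+ 2 - Q ^+ 2 - 2 * Q * (w * (G x 0 i - G z 0 i) + w' * t)) +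
    2 * Q * (w * (G x 0 i - G z 0 i - m)) by ring.
  apply: le_trans (ler_normD _ _) _; rewrite 3!normrM (ger0_norm (ler0n _ 2)).
  have a1 := sqr_phiFB_taylor (G z 0 i) (- xi z 0 i) (G x 0 i) (- xi x 0 i).
  have a1' : (`|G x 0 i - G z 0 i| + `|t|) ^+ 2 <= (L + 1) ^+ 2 * `|x - z| ^+ 2.
    rewrite -exprMn lerXn2r ?nnegrE ?mulr_ge0 ?addr_ge0//.
    by apply: le_trans (FB_args_le x z i) _; rewrite mulrDl mul1r lerD2r.
  have a2 : `|G x 0 i - G z 0 i - m| <= e * `|x - z|.
    apply: le_trans h2; have := norm_coord_le (G x - G z - (x - z) *m (Jac G z)^T) 0 i.
    by rewrite /m !mxE.
  have a3 : `|Q| * (`|w| * `|G x 0 i - G z 0 i - m|) <= `|F z| * (2 * (e * `|x - z|)).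
    by rewrite ler_pM ?mulr_ge0// ler_pM// FBw_norm.
  have a4 : 0 <= `|F z| * (e * `|x - z|) by rewrite !mulr_ge0// ltW.
  have a5 : 0 <= `|F z| * `|x - z| ^+ 2 by rewrite mulr_ge0 ?sqr_ge0.
  have a6 : 0 <= (K ^+ 2 + 10 * (L + 1) ^+ 2) * (e * `|x - z|).
    by apply: mulr_ge0; [lra|rewrite mulr_ge0// ltW].
  have a7 : 0 <= K ^+ 2 * `|x - z| ^+ 2 by rewrite mulr_ge0 ?sqr_ge0.
  rewrite /C; move: a1; rewrite -/P -/Q -/w -/w' -/t => a1.
  rewrite mulrA in a3; rewrite mulrA.
  clear -a1 a1' a3 a4 a5 a6 a7; nra.
have -> : Psi x - Psi z - df (x - z) =
  2^-1 * \sum_k (F x 0 k ^+ 2 - F z 0 k ^+ 2 - 2 * F z 0 k * l 0 k).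
  rewrite /df/= dotrC dotr_mulmx dotrC -/l !PsiE /dotr !sumrB !mulrBr; congr (_ * _ - _ * _ - _).
  - rewrite mulr_sumr; apply: eq_bigr => k _; rewrite !mulrA mulVf// mul1r.
    by rewrite mulrC.
rewrite normrM ger0_norm ?invr_ge0//.
apply: (@le_trans _ _ (\sum_k `|F x 0 k ^+ 2 - F z 0 k ^+ 2 - 2 * F z 0 k * l 0 k|)).
  apply: le_trans (ler_wpM2l _ (ler_norm_sum _ _ _)) _; first by rewrite invr_ge0.
  by rewrite ler_piMl ?sumr_ge0// invf_le1// ler1n.
apply: le_trans (ler_sum _ (fun k _ => term k)) _.
by rewrite sumr_const card_ord -[leLHS]mulr_natl !mulrA.
Qed.

End merit_function.

(** * The gradient of the merit function and its continuity *)

Section gradient.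
Context {R : realType} {p1 p2 q1 : nat}.
Variables (H : 'rV[R]_(p1 + p2) -> 'rV[R]_q1) (G : 'rV[R]_(p1 + p2) -> 'rV[R]_p2).
Local Notation p := (p1 + p2)%N.
Local Notation F := (FFB H G).
Local Notation DN := (DNFFB H G).
Local Notation Psi := (PsiFB H G).
Local Notation xi := rsubmx.
Hypothesis HC : continuously_differentiable H.
Hypothesis GC : continuously_differentiable G.

Lemma Psi_differentiable z : differentiable Psi z.
Proof. by case: (Psi_is_diff HC GC z). Qed.

Lemma Psi_continuous : continuous Psi.
Proof. by move=> z; apply: differentiable_continuous; exact: Psi_differentiable. Qed.

Lemma grad_Psi z : grad Psi z = F z *m DN z.
Proof.
apply/rowP => j; rewrite mxE deriveE; last exact: Psi_differentiable.
have [_ ->] := Psi_is_diff HC GC z.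
by rewrite /dotr -[RHS]mul1r (bigD1 j)//= big1 ?addr0 => [|k kj];
  rewrite mxE eqxx/= ?eqxx// (negbTE kj) mul0r.
Qed.

Lemma diff_Psi z v : 'd Psi z v = dotr v (grad Psi z).
Proof. by have [_ ->] := Psi_is_diff HC GC z; rewrite grad_Psi. Qed.

Let P z : 'rV[R]_p2 := \row_i (phiFB (G z 0 i) (- xi z 0 i) * va G z 0 i).
Let Q z : 'rV[R]_p2 := \row_i (phiFB (G z 0 i) (- xi z 0 i) * vb G z 0 i).

(** Regrouping [F z *m DN z] so that each weight meets its factor [phiFB]: the products [P] and [Q]
    are continuous although the weights are not. *)
Lemma grad_PsiE z :
  grad Psi z = H z *m Jac H z + P z *m Jac G z - row_mx 0 (Q z).
Proof.
have dotr_eq (u w : 'rV[R]_p) : (forall v, dotr v u = dotr v w) -> u = w.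
  move=> h; apply/eqP; rewrite -subr_eq0; apply/eqP/enorm_eq0.
  by rewrite enormE dotrDr dotrNr h subrr sqrtr0.
apply: dotr_eq => v; rewrite grad_Psi -[DN z]trmxK -dotr_mulmx mulmx_DN.
have eq_tr k (A : 'M[R]_(k, p)) (w : 'rV_k) : dotr v (w *m A) = dotr (v *m A^T) w.
  by rewrite dotr_mulmx trmxK.
rewrite !dotrDr dotrNr !eq_tr.
rewrite [LHS]/dotr big_split_ord/= -addrA; congr (_ + _).
  by apply: eq_bigr => i _; rewrite FFBl row_mxEl.
rewrite [X in _ - X]/dotr big_split_ord/= [X in _ - (X + _)]big1 ?add0r; last first.
  by move=> i _; rewrite row_mxEl mxE mulr0.
rewrite -sumrB; apply: eq_bigr => i _.
by rewrite FFBr !row_mxEr [in LHS]mxE [P z 0 i]mxE [Q z 0 i]mxE [xi v 0 i]mxE; ring.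
Qed.

Lemma phiFB_w_continuous (u v : 'rV[R]_p -> R) z :
  {for z, continuous u} -> {for z, continuous v} ->
  {for z, continuous (fun x => phiFB (u x) (v x) * FBw (u x) (v x))}.
Proof.
move=> /continuous_normP cu /continuous_normP cv; apply/continuous_normP => e e0.
(* The Lipschitz constant 10 acts on the sum of two increments. *)
have e1 : 0 < e / 20 by lra.
near=> x.
have h1 : `|u x - u z| < e / 20 by near: x; exact: cu.
have h2 : `|v x - v z| < e / 20 by near: x; exact: cv.
by have := phiFB_w_lipschitz (u z) (v z) (u x) (v x); lra.
Unshelve. all: by end_near. Qed.

Lemma grad_Psi_continuous : continuous (grad Psi).
Proof.
move=> z; have -> : grad Psi = fun z =>
    H z *m Jac H z + P z *m Jac G z + (- row_mx 0 (Q z)).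
  by apply/funext => x; exact: grad_PsiE.
have cG i : {for z, continuous (fun x => G x 0 i)}.
  by apply: coord_continuous_for; exact: C1_continuous.
have cx i : {for z, continuous (fun x => - xi x 0 i)}.
  have -> : (fun x : 'rV[R]_p => - xi x 0 i) = (fun x => - x 0 (rshift p1 i)).
    by apply/funext => x; rewrite mxE.
  by apply: continuousN; exact: coord_continuous.
have c1 : {for z, continuous (fun x => H x *m Jac H x)}.
  by apply: mulmx_continuous; [exact: C1_continuous|exact: HC.2].
have c2 : {for z, continuous (fun x => P x *m Jac G x)}.
  apply: mulmx_continuous; last exact: GC.2.
  apply: mx_continuous => i j; rewrite ord1.
  have -> : (fun x => P x 0 j) = (fun x => phiFB (G x 0 j) (- xi x 0 j) *
      FBw (G x 0 j) (- xi x 0 j)) by apply/funext => x; rewrite mxE vaE.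
  exact: phiFB_w_continuous.
have c3 : {for z, continuous (fun x => row_mx 0 (Q x) : 'rV[R]_p)}.
  apply: mx_continuous => i j; rewrite ord1.
  rewrite -[j]splitK; case: (fintype.split j) => k /=.
    have -> : (fun x => row_mx 0 (Q x) 0 (lshift p2 k)) = cst 0.
      by apply/funext => x; rewrite row_mxEl mxE.
    exact: (@cst_continuous _ _ 0).
  have -> : (fun x => row_mx 0 (Q x) 0 (rshift p1 k)) = (fun x =>
      phiFB (- xi x 0 k) (G x 0 k) * FBw (- xi x 0 k) (G x 0 k)).
    apply/funext => x; rewrite row_mxEr mxE vbE; congr (_ * _).
    by rewrite /phiFB [X in X + _]addrC [X in Num.sqrt X]addrC.
  exact: phiFB_w_continuous.
exact: (cvgD (cvgD c1 c2) (cvgN c3)).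
Qed.

End gradient.

(** * Sufficient decrease *)

Section descent.
Context {R : realType} {p1 p2 q1 : nat}.
Variables (H : 'rV[R]_(p1 + p2) -> 'rV[R]_q1) (G : 'rV[R]_(p1 + p2) -> 'rV[R]_p2).
Variables (kappa sigma beta rho gamma1 gamma2 : R).
Local Notation p := (p1 + p2)%N.
Local Notation DN := (DNFFB H G).
Local Notation Psi := (PsiFB H G).
Local Notation nu := (LM_nu H G gamma1 gamma2).
Hypothesis HC : continuously_differentiable H.
Hypothesis GC : continuously_differentiable G.
Hypothesis kappa01 : 0 < kappa < 1.
Hypothesis sigma01 : 0 < sigma < 1.
Hypothesis beta01 : 0 < beta < 1.
Hypothesis rho_gt0 : 0 < rho.
Hypothesis gamma1_gt0 : 0 < gamma1.
Hypothesis gamma2_gt0 : 0 < gamma2.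

Lemma LM_nu_ge0 x : 0 <= nu x.
Proof. by rewrite le_min ltW// mulr_ge0 ?enorm_ge0// ltW. Qed.

Lemma LM_system_row x d : LM_system H G gamma1 gamma2 x d ->
  (d *m (DN x)^T) *m DN x + nu x *: d = - grad Psi x.
Proof.
move=> /(congr1 (@trmx _ _ _)); rewrite trmx_mul trmxK [RHS]linearN/= trmxK => <-.
by rewrite linearD/= trmx_mul trmxK tr_scalar_mx mulmxDr mul_mx_scalar mulmxA.
Qed.

(** Testing the system with the gradient [g] bounds [enorm g ^+ 2] by
    [(M ^+ 2 + gamma1) * enorm d * enorm g]. Thus directions cannot be short where the gradient is
    not small. *)
Lemma grad_le_direction x d M : 0 <= M ->
  (forall v, enorm (v *m (DN x)^T) <= M * enorm v) ->
  LM_system H G gamma1 gamma2 x d ->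
  enorm (grad Psi x) <= (M ^+ 2 + gamma1) * enorm d.
Proof.
move=> M0 hM /LM_system_row hd; set g := grad Psi x in hd *.
have g0 := enorm_ge0 g; have d0 := enorm_ge0 d.
have [->|gn0] := eqVneq (enorm g) 0.
  by rewrite mulr_ge0// addr_ge0 ?sqr_ge0// ltW.
have ggt0 : 0 < enorm g by rewrite lt_neqAle eq_sym gn0.
rewrite -(ler_pM2r ggt0) -expr2 enorm_sqr -[leLHS]opprK -dotrNl -hd dotrDl dotrZl.
rewrite dotr_mulmx opprD.
have h1 := normr_dotr (d *m (DN x)^T) (g *m (DN x)^T).
have h2 := normr_dotr d g.
have n0 := LM_nu_ge0 x.
have n1 : nu x <= gamma1 by rewrite ge_min lexx.
have h3 : enorm (d *m (DN x)^T) * enorm (g *m (DN x)^T) <= (M * enorm d) * (M * enorm g).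
  by rewrite ler_pM ?enorm_ge0.
have h4 : nu x * `|dotr d g| <= gamma1 * (enorm d * enorm g) by rewrite ler_pM.
have h5 := ler_norm (- dotr (d *m (DN x)^T) (g *m (DN x)^T)).
have h6 : - (nu x * dotr d g) <= nu x * `|dotr d g|.
  by rewrite -mulrN ler_wpM2l// -normrN ler_norm.
rewrite normrN in h5; nra.
Qed.

(** The angle condition holds with constant [rho] if [d] is kept and with constant 1 if it is
    replaced by the negative gradient, hence the minimum. *)
Lemma search_direction_slope x d :
  let d' := LM_search_direction H G rho x d in
  dotr d' (grad Psi x) <=
    - (Num.min rho 1 * enorm (grad Psi x) * enorm d').
Proof.
move=> /=; rewrite /LM_search_direction diff_Psi//; set g := grad Psi x.
have gg : 0 <= enorm g * enorm g by rewrite mulr_ge0 ?enorm_ge0.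
have gd : 0 <= enorm g * enorm d by rewrite mulr_ge0 ?enorm_ge0.
case: ltP => h.
  rewrite dotrNl enormN -enorm_sqr lerN2 -mulrA expr2 ler_piMl// ge_min lexx orbT//.
apply: le_trans h _; rewrite mulNr mulNr lerN2 -!mulrA ler_wpM2r//.
by rewrite ge_min lexx.
Qed.

Lemma search_direction_descent x d :
  dotr (LM_search_direction H G rho x d) (grad Psi x) <= 0.
Proof.
apply: le_trans (search_direction_slope x d) _.
by rewrite oppr_le0 !mulr_ge0 ?enorm_ge0// le_min ler01 ltW.
Qed.

Lemma update_decreasing x d x' :
  LM_update H G kappa sigma beta rho x d x' -> Psi x' <= Psi x.
Proof.
have /andP[k0 k1] := kappa01; have /andP[s0 s1] := sigma01.
have /andP[b0 b1] := beta01.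
rewrite /LM_update; case: ifP => [t ->|_ [i [_ + _ ->]]].
  by apply: le_trans t _; rewrite ler_piMl ?Psi_ge0// ltW.
rewrite /armijo diff_Psi// => /le_trans; apply.
rewrite gerDl mulr_ge0_le0// ?search_direction_descent//.
by rewrite mulr_ge0 ?exprn_ge0 ?ltW.
Qed.

(** The arithmetic behind a rejected trial step: [a] is the slope at the start and [b] the one at
    the mean value point. If [b] exceeds [a] by at most half of the margin
    [(1 - s) * r * (g / 2) * V], then [b <= a * s], so the Armijo test could not have failed. *)
Lemma slope_contra (s r g V a b y y' : R) :
  s < 1 -> 0 < r -> 0 < g -> 0 <= V ->
  b <= a + 2 * ((1 - s) * r * g / 8) * V -> a <= - (r * (g / 2) * V) ->
  y' - y = b -> y + a * s < y' -> False.
Proof.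
move=> s1 r0 g0 V0 hb ha yE hy.
have h7 : (1 - s) * a <= (1 - s) * - (r * (g / 2) * V).
  by rewrite ler_wpM2l// subr_ge0 ltW.
have h8 : 0 <= (1 - s) * r * g * V by rewrite !mulr_ge0 ?subr_ge0// ltW.
by nra.
Qed.

(* When [beta ^+ i] is the accepted step and [i > 1], the rejected step
   [beta ^+ i.-1] cannot be short, for on short steps the slope is nearly constant. *)
Lemma update_sufficient_decrease zbar : grad Psi zbar != 0 ->
  exists2 e : R, 0 < e & exists2 r : R, 0 < r & forall x d x',
    `|x - zbar| < r -> LM_system H G gamma1 gamma2 x d ->
    LM_update H G kappa sigma beta rho x d x' -> Psi x' <= Psi x - e.
Proof.
move=> gbar; have /andP[k0 k1] := kappa01; have /andP[s0 s1] := sigma01.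
have /andP[b0 b1] := beta01.
pose g0 := enorm (grad Psi zbar).
have g0_gt0 : 0 < g0.
  rewrite lt_neqAle enorm_ge0 andbT eq_sym; apply: contra gbar => /eqP h.
  by rewrite (enorm_eq0 h).
have Psi_gt0 : 0 < Psi zbar.
  rewrite lt_neqAle Psi_ge0 andbT eq_sym; apply: contra gbar => /eqP h.
  by rewrite grad_Psi// (Psi_eq0 h) mul0mx.
pose rho' := Num.min rho 1.
have r0 : 0 < rho' by rewrite lt_min rho_gt0 ltr01.
have r1 : rho' <= 1 by rewrite ge_min lexx orbT.
(* The permitted variation of the gradient near [zbar]: [2 * eta] is half of the margin used in
   [slope_contra], and [eta <= g0 / 2] keeps the gradient at least half as long as at [zbar]. *)
pose eta := (1 - sigma) * rho' * g0 / 8.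
have sr_gt0 : 0 < (1 - sigma) * rho' by rewrite mulr_gt0// subr_gt0.
have sr_le1 : (1 - sigma) * rho' <= 1 by nra.
have eta_gt0 : 0 < eta by rewrite /eta divr_gt0// mulr_gt0.
have eta_le : eta <= g0 / 2 by rewrite /eta; nra.
have eta1 : 0 < eta / (p%:R + 1) by rewrite divr_gt0// ltr_wpDl.
have cg : {for zbar, continuous (grad Psi)} by exact: grad_Psi_continuous.
have cP : {for zbar, continuous Psi} by exact: Psi_continuous.
have /near_normP[d1 d10 hd1] := (continuous_normP _ _).1 cg _ eta1.
have {}hd1 x : `|x - zbar| < d1 -> enorm (grad Psi x - grad Psi zbar) <= eta.
  move=> /hd1/ltW h; apply: le_trans (enorm_le _) _.
  apply: le_trans (ler_wpM2l _ h) _; first by rewrite ler0n.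
  by rewrite mulrCA ler_piMr ?ltW// ltr_pdivrMr ?mul1r ?ltrDl// ltr_wpDl.
have [M M0 [d2 d20 hM]] := DN_bounded HC GC zbar.
have P2 : 0 < Psi zbar / 2 by rewrite divr_gt0.
have /near_normP[d3 d30 hd3] := (continuous_normP _ _).1 cP _ P2.
(* The halving leaves room for a trial step shorter than [r] taken from a point within [r] of
   [zbar]. *)
pose r := Num.min (Num.min d1 d2) d3 / 2.
have r_gt0 : 0 < r by rewrite divr_gt0// !lt_min d10 d20.
have [rd1 rd2 rd3] : [/\ 2 * r <= d1, 2 * r <= d2 & 2 * r <= d3].
  by rewrite /r mulrC divfK//; split; rewrite !ge_min lexx ?orbT.
clearbody r.
(* The summand 1 makes [c <= 1], so that [c * enorm (grad Psi x)] bounds the length of the search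
   direction from below also when it is the negative gradient. *)
pose c := (M ^+ 2 + gamma1 + 1)^-1.
have C0 : 0 < M ^+ 2 + gamma1 + 1.
  by have := sqr_ge0 M; move: gamma1_gt0; lra.
have c0 : 0 < c by rewrite invr_gt0.
(* Guaranteed decrease in the three cases: test of step 2 passed, Armijo exponent 1, larger Armijo
   exponent. *)
pose e1 := (1 - kappa) * (Psi zbar / 2).
pose e2 := sigma * rho' * (g0 / 2) * (beta * (c * (g0 / 2))).
pose e3 := sigma * rho' * (g0 / 2) * (beta * r).
have e1_gt0 : 0 < e1 by rewrite mulr_gt0// subr_gt0.
have e2_gt0 : 0 < e2 by rewrite !mulr_gt0 ?invr_gt0.
have e3_gt0 : 0 < e3 by rewrite !mulr_gt0 ?invr_gt0.
have sg0 : 0 < sigma * rho' * (g0 / 2) by rewrite !mulr_gt0 ?invr_gt0.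
exists (Num.min e1 (Num.min e2 e3)); first by rewrite !lt_min e1_gt0 e2_gt0.
exists r => // x d x' xr hd.
have suff_e e : e \in [:: e1; e2; e3] -> Psi x' <= Psi x - e ->
    Psi x' <= Psi x - Num.min e1 (Num.min e2 e3).
  move=> he /le_trans; apply; rewrite lerD2l lerN2.
  by move: he; rewrite !inE => /or3P[] /eqP ->; rewrite !ge_min lexx ?orbT.
have xd1 : `|x - zbar| < d1 by lra.
have gx1 := hd1 _ xd1.
have gx : g0 / 2 <= enorm (grad Psi x).
  by apply: enorm_half; exact: le_trans gx1 eta_le.
rewrite /LM_update; case: ifP => [t xE|_ [i [i0 ar imin xE]]].
  apply: (suff_e e1); first by rewrite inE eqxx.
  rewrite xE; apply: le_trans t _; rewrite /e1.
  have /hd3 : `|x - zbar| < d3 by lra.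
  by rewrite ltr_norml => /andP[h _]; nra.
set d' := LM_search_direction H G rho x d in ar imin xE.
have slope := search_direction_slope x d; rewrite -/d' -/rho' in slope.
have d'0 := enorm_ge0 d'.
move: ar; rewrite /armijo diff_Psi// -xE => ar.
have bi0 : 0 < beta ^+ i by rewrite exprn_gt0.
have slope' : dotr d' (grad Psi x) <= - (rho' * (g0 / 2) * enorm d').
  apply: le_trans slope _; rewrite lerN2.
  by apply: ler_wpM2r => //; apply: ler_wpM2l => //; exact: ltW r0.
have decr a : a <= beta ^+ i * enorm d' ->
    Psi x' <= Psi x - sigma * rho' * (g0 / 2) * a.
  move=> ha; apply: le_trans ar _; rewrite lerD2l.
  have h3 : beta ^+ i * sigma * dotr d' (grad Psi x) <=
     beta ^+ i * sigma * - (rho' * (g0 / 2) * enorm d').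
    by rewrite ler_wpM2l// mulr_ge0 ?ltW.
  apply: le_trans h3 _.
  have h4 : sigma * rho' * (g0 / 2) * a <= sigma * rho' * (g0 / 2) * (beta ^+ i * enorm d').
    by rewrite ler_wpM2l// ltW.
  by rewrite mulrN lerN2; apply: le_trans h4 _; rewrite le_eqVlt; apply/orP; left; apply/eqP; ring.
(* Exponent 1 has no rejected predecessor, and there the step length comes from [grad_le_direction].
   Otherwise the exponent is [j.+2] and the trial [j.+1] was rejected; the accepted step is [beta]
   times that trial [v]. *)
case: i i0 {ar} imin bi0 decr {xE} => // -[_ _ _ decr|j _ imin _ decr].
  apply: (suff_e e2); first by rewrite !inE eqxx orbT.
  apply: decr; rewrite expr1 ler_pM2l//.
  apply: (@le_trans _ _ (c * enorm (grad Psi x))); first by rewrite ler_wpM2l// ltW.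
  rewrite /d' /LM_search_direction; case: ifP => _.
    rewrite enormN ler_piMl ?enorm_ge0// invf_le1//.
    by have := sqr_ge0 M; move: gamma1_gt0; lra.
  rewrite /c mulrC ler_pdivrMr// mulrC.
  have hMx v : enorm (v *m (DN x)^T) <= M * enorm v by apply: hM; lra.
  apply: le_trans (grad_le_direction M0 hMx hd) _.
  by rewrite ler_wpM2r ?enorm_ge0// lerDl.
apply: (suff_e e3); first by rewrite !inE eqxx !orbT.
apply: decr; rewrite exprS -mulrA ler_pM2l//.
pose v := beta ^+ j.+1 *: d'.
have bj0 : 0 < beta ^+ j.+1 by rewrite exprn_gt0.
have vE : enorm v = beta ^+ j.+1 * enorm d' by rewrite enormZ gtr0_norm.
rewrite -vE leNgt; apply/negP => vr.
have : ~~ armijo H G sigma beta x d' j.+1.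
  by apply/negP => /(imin j.+1 isT); rewrite ltnn.
rewrite /armijo diff_Psi// -/v -ltNge.
have [t t01] := segment_MVT x v (Psi_differentiable HC GC).
rewrite diff_Psi// => mvt.
have hz : `|x + t *: v - zbar| < d1.
  have tv : `|t *: v| <= `|v|.
    by case/andP: t01 => t0 t1; rewrite normrZ ger0_norm// ler_piMl.
  rewrite addrAC; apply: le_lt_trans (ler_normD _ _) _.
  apply: lt_le_trans rd1; rewrite mulrDl mul1r; apply: ltrD xr _.
  by apply: le_lt_trans vr; apply: le_trans tv _; exact: norm_le_enorm.
have h4 := dotr_near v gx1 (hd1 _ hz).
have h5 : dotr v (grad Psi x) <= - (rho' * (g0 / 2) * enorm v).
  by rewrite dotrZl vE mulrCA -mulrN ler_pM2l.
have V0 := enorm_ge0 v.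
rewrite mulrAC -[_ * dotr d' _]dotrZl -/v.
move=> h6; exact: (slope_contra s1 r0 g0_gt0 V0 h4 h5 mvt h6).
Qed.

End descent.

(** * Global convergence *)

Lemma infinite_set_ge (A : set nat) N : infinite_set A ->
  exists2 k, (N <= k)%N & A k.
Proof.
move=> Ainf; apply: contrapT => h; apply: Ainf.
apply: (@sub_finite_set _ _ `I_N); last exact: finite_II.
move=> k Ak /=; rewrite ltnNge; apply/negP => Nk; apply: h; exists k => //.
Qed.

Lemma accumulation_point_near (R : realType) n (z : nat -> 'rV[R]_n) zbar (r : R) N :
  accumulation_point z zbar -> 0 < r -> exists2 k, (N <= k)%N & `|z k - zbar| < r.
Proof.
move=> acc r0.
have h1 : (z @ \oo) (z @` [set k | (N <= k)%N]) by exists N => // k Nk; exists k.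
have h2 : nbhs zbar [set x | `|x - zbar| < r].
  by apply: (near_normP zbar (fun x => `|x - zbar| < r : Prop)).2; exists r.
by have [_ [[k Nk <-] kr]] := acc _ _ h1 h2; exists k.
Qed.

Section iterates.
Context {R : realType} {p1 p2 q1 : nat}.
Variables (H : 'rV[R]_(p1 + p2) -> 'rV[R]_q1) (G : 'rV[R]_(p1 + p2) -> 'rV[R]_p2).
Variables (kappa tau_abs sigma beta rho gamma1 gamma2 : R).
Variables (z d : nat -> 'rV[R]_(p1 + p2)).
Local Notation Psi := (PsiFB H G).
Hypothesis HC : continuously_differentiable H.
Hypothesis GC : continuously_differentiable G.
Hypothesis kappa01 : 0 < kappa < 1.
Hypothesis sigma01 : 0 < sigma < 1.
Hypothesis beta01 : 0 < beta < 1.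
Hypothesis rho_gt0 : 0 < rho.
Hypothesis gamma1_gt0 : 0 < gamma1.
Hypothesis gamma2_gt0 : 0 < gamma2.
Hypothesis zd_gen : LM_generated H G kappa tau_abs sigma beta rho gamma1 gamma2 z d.

Lemma Psi_iterates m k : (m <= k)%N -> Psi (z k) <= Psi (z m).
Proof.
elim: k => [|k IH]; first by rewrite leqn0 => /eqP ->.
rewrite leq_eqVlt => /predU1P[->//|]; rewrite ltnS => /IH; apply: le_trans.
by have [_ _] := zd_gen k; exact: update_decreasing.
Qed.

Lemma Psi_iterates_cvg0 :
  infinite_set [set k : nat | LM_test H G kappa (z k) (d k)] ->
  Psi (z k) @[k --> \oo] --> (0 : R).
Proof.
move=> tinf; have /andP[k0 k1] := kappa01.
(* Each passed test contributes a factor [kappa], and [Psi] does not increase in between. *)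
have geo m : exists k, Psi (z k) <= kappa ^+ m * Psi (z 0%N).
  elim: m => [|m [k IH]]; first by exists 0%N; rewrite expr0 mul1r.
  have [l kl tl] := infinite_set_ge k tinf; exists l.+1.
  have [_ _] := zd_gen l; rewrite /LM_update tl => ->.
  apply: le_trans tl _; rewrite exprS -mulrA ler_pM2l//.
  exact: le_trans (Psi_iterates kl) IH.
have ge0 := @Psi_ge0 _ _ _ _ H G.
apply/cvgrPdist_lt => e e0.
have : geometric (Psi (z 0%N)) kappa @ \oo --> (0 : R).
  by apply: cvg_geometric; rewrite ger0_norm ?ltW.
move=> /cvgrPdist_lt/(_ e e0)[N _ /(_ N (leqnn N))]; rewrite sub0r normrN /=.
have [k hk] := geo N; rewrite ger0_norm; last first.
  by rewrite mulr_ge0// exprn_ge0// ltW.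
rewrite mulrC => hN; exists k => // l kl /=.
rewrite sub0r normrN ger0_norm//; apply: le_lt_trans hN.
exact: le_trans (Psi_iterates kl) hk.
Qed.

Lemma accumulation_point_solution zbar :
  Psi (z k) @[k --> \oo] --> (0 : R) -> accumulation_point z zbar ->
  MNLCS H G zbar.
Proof.
move=> cv0 acc; apply/FFB_eq0/Psi_eq0/eqP; rewrite eq_le Psi_ge0 andbT.
apply/ler_addgt0Pr => e e0; rewrite add0r.
have e2 : 0 < e / 2 by rewrite divr_gt0.
have cP : {for zbar, continuous Psi} by exact: Psi_continuous.
have /near_normP[r r0 hr] := (continuous_normP _ _).1 cP _ e2.
move/cvgrPdist_lt/(_ _ e2): cv0 => [N _ hN].
have [k Nk /hr] := accumulation_point_near N acc r0.
have := hN k Nk; rewrite /= sub0r normrN => /(le_lt_trans (ler_norm _)).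
by rewrite ltr_norml => h1 /andP[h2 _]; lra.
Qed.

Lemma accumulation_point_stationary zbar :
  accumulation_point z zbar -> stationary Psi zbar.
Proof.
move=> acc; apply/eqP; apply: contrapT => /negP gbar.
have [e e0 [r r0 hdec]] := update_sufficient_decrease HC GC kappa01 sigma01
  beta01 rho_gt0 gamma1_gt0 gamma2_gt0 gbar.
(* After [m] visits to the ball around [zbar] at least [m%:R * e] has been lost, which in the end
   contradicts [Psi >= 0]. *)
have low m : exists k, Psi (z k) <= Psi (z 0%N) - m%:R * e.
  elim: m => [|m [k IH]]; first by exists 0%N; rewrite mul0r subr0.
  have [l kl zl] := accumulation_point_near k acc r0; exists l.+1.
  have [_ [ld _] lu] := zd_gen l.
  apply: le_trans (hdec _ _ _ zl ld lu) _; rewrite mulrSr mulrDl mul1r opprD addrA.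
  by rewrite lerD2r; exact: le_trans (Psi_iterates kl) IH.
have [m hm] : exists m : nat, Psi (z 0%N) / e < m%:R.
  exists (Num.bound (Psi (z 0%N) / e)); apply: archi_boundP.
  by rewrite divr_ge0 ?Psi_ge0// ltW.
have [k hk] := low m.
have := le_trans (Psi_ge0 H G (z k)) hk.
by rewrite subr_ge0 -ler_pdivlMr// leNgt hm.
Qed.

End iterates.

(** * Newton residual and limit weights at a solution *)

Section weights.
Context {R : realType}.
Implicit Types a b : R.

Lemma FBw_neg0 a : a < 0 -> FBw a 0 = 0 /\ FBw 0 a = 1.
Proof.
move=> a0; have h : hyp a 0 = - a.
  by rewrite /hyp expr0n addr0 sqrtr_sqr ltr0_norm.
have h0 : 0 < hyp a 0 by rewrite h oppr_gt0.
rewrite FBw_neq0// FBw_neq0r// h mul0r addr0 invrN mulrN divff ?subrr//.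
by rewrite lt_eqF.
Qed.

Lemma FBw_near a b e : 0 < hyp a b -> 0 < e ->
  exists2 r, 0 < r & forall c d, `|c - a| + `|d - b| < r ->
    `|FBw c d - FBw a b| <= e.
Proof.
move=> h0 e0; exists (Num.min (hyp a b) (hyp a b * e / 2)).
  by rewrite lt_min h0 divr_gt0// mulr_gt0.
move=> c d; rewrite lt_min => /andP[h1 h2].
have hcd : 0 < hyp c d.
  by have := hypB_le a b c d; rewrite ler_norml => /andP[+ _]; lra.
apply: le_trans (FBw_continuity h0 hcd) _; rewrite ler_pdivrMr// mulrC.
by move: h2; rewrite ltr_pdivlMr// mulrC => /ltW; rewrite (mulrC e).
Qed.

End weights.

Section local_analysis.
Context {R : realType} {p1 p2 q1 : nat}.
Variables (H : 'rV[R]_(p1 + p2) -> 'rV[R]_q1) (G : 'rV[R]_(p1 + p2) -> 'rV[R]_p2).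
Local Notation p := (p1 + p2)%N.
Local Notation F := (FFB H G).
Local Notation DN := (DNFFB H G).
Local Notation xi := rsubmx.
Hypothesis HC : continuously_differentiable H.
Hypothesis GC : continuously_differentiable G.
Variable zbar : 'rV[R]_(p1 + p2).
Hypothesis zbar_sol : MNLCS H G zbar.

Lemma FFB_sol : F zbar = 0.
Proof. exact/FFB_eq0. Qed.

Lemma phiFB_sol i : phiFB (G zbar 0 i) (- xi zbar 0 i) = 0.
Proof. by rewrite -(FFBr H) FFB_sol mxE. Qed.

Lemma FB_args_near : exists2 L : R, 0 <= L & exists2 r : R, 0 < r &
  forall x i, `|x - zbar| < r ->
    `|G x 0 i - G zbar 0 i| + `|- xi x 0 i - - xi zbar 0 i| <= L * `|x - zbar|.
Proof.
have [L L0 [r r0 hL]] := C1_calm zbar GC.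
exists (L + 1); first by rewrite addr_ge0.
exists r => // x i /hL h; apply: le_trans (FB_args_le G x zbar i) _.
by rewrite mulrDl mul1r lerD2r.
Qed.

Lemma near_forall_ord (n : nat) (P : 'I_n -> 'rV[R]_p -> Prop) :
  (forall i, exists2 r : R, 0 < r & forall x, `|x - zbar| < r -> P i x) ->
  exists2 r : R, 0 < r & forall x, `|x - zbar| < r -> forall i, P i x.
Proof.
move=> h; apply/near_normP.
have hn i : \forall x \near zbar, P i x by exact/near_normP.
near=> x.
by near: x; exact: (filter_forall _ hn).
Unshelve. all: by end_near. Qed.

Let TH x := `|H x - H zbar - (x - zbar) *m (Jac H x)^T|.
Let TG x := `|G x - G zbar - (x - zbar) *m (Jac G x)^T|.

(** The Taylor errors [TH] and [TG] are left unestimated so that the bound yields both the little-o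
    and the quadratic version; the factor 2 is the bound on the weights. The remaining term is the
    error of [phiFB_newton], always quadratic. *)
Lemma newton_residual : exists2 C : R, 0 <= C & exists2 r : R, 0 < r &
  forall x, `|x - zbar| < r ->
  `|F x - (x - zbar) *m (DN x)^T| <= C * `|x - zbar| ^+ 2 + TH x + 2 * TG x.
Proof.
have [L L0 [r r0 hL]] := FB_args_near.
have hi i : exists K : R, 0 <= K /\ exists2 e : R, 0 < e & forall x, `|x - zbar| < e ->
    `|phiFB (G x 0 i) (- xi x 0 i) -
      (va G x 0 i * (G x 0 i - G zbar 0 i) +
       vb G x 0 i * (- xi x 0 i - - xi zbar 0 i))| <= K * `|x - zbar| ^+ 2.
  have [K K0 [e e0 hK]] := phiFB_newton (phiFB_sol i).
  exists (K * L ^+ 2); split; first by rewrite mulr_ge0 ?sqr_ge0.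
  exists (Num.min r (e / (L + 1))).
    by rewrite lt_min r0 divr_gt0// ltr_wpDl.
  move=> x; rewrite lt_min => /andP[/(hL x i) hx hxe].
  have hN : `|G x 0 i - G zbar 0 i| + `|- xi x 0 i - - xi zbar 0 i| < e.
    apply: le_lt_trans hx _; move: hxe; rewrite ltr_pdivlMr ?ltr_wpDl//.
    by apply: le_lt_trans; rewrite mulrDr mulr1 mulrC lerDl.
  rewrite vaE vbE; apply: le_trans (hK _ _ hN) _; rewrite -mulrA ler_wpM2l//.
  by rewrite -exprMn lerXn2r ?nnegrE ?addr_ge0// mulr_ge0.
(* The constants depend on the index; their sum dominates each of them. *)
have [K hK] := choice hi.
pose C := \sum_i K i.
have KC i : K i <= C.
  rewrite /C (bigD1 i)//= lerDl sumr_ge0// => j _; exact: (hK j).1.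
have C0 : 0 <= C by apply: sumr_ge0 => j _; exact: (hK j).1.
have [e e0 he] := near_forall_ord (fun i => (hK i).2).
exists C => //; exists e => // x /he {}he.
have D0 : 0 <= C * `|x - zbar| ^+ 2 by rewrite mulr_ge0 ?sqr_ge0.
have TH0 : 0 <= TH x by exact: normr_ge0.
have TG0 : 0 <= TG x by exact: normr_ge0.
apply: norm_mx_le => [|u j]; first by move: TH0 TG0 D0; clear; lra.
rewrite ord1 mulmx_DN -[j]splitK; case: (fintype.split j) => k /=.
  rewrite mxE [X in _ + X]mxE FFBl FBlinEl.
  have := norm_coord_le (H x - H zbar - (x - zbar) *m (Jac H x)^T) 0 k.
  have [H0 _ _ _] := zbar_sol.
  rewrite -/(TH x) H0 subr0 mxE [X in `|_ + X|]mxE => h.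
  by apply: le_trans h _; move: TH0 TG0 D0; clear; lra.
rewrite mxE [X in _ + X]mxE FFBr FBlinEr.
set m := (_ *m _) 0 k; set P := phiFB _ _.
have -> : xi (x - zbar) 0 k = - (- xi x 0 k - - xi zbar 0 k) by rewrite !mxE; ring.
have hk := he k; rewrite -/P in hk.
have -> : P - (va G x 0 k * m - vb G x 0 k * - (- xi x 0 k - - xi zbar 0 k)) =
  (P - (va G x 0 k * (G x 0 k - G zbar 0 k) +
        vb G x 0 k * (- xi x 0 k - - xi zbar 0 k))) +
  va G x 0 k * (G x 0 k - G zbar 0 k - m) by ring.
apply: le_trans (ler_normD _ _) _; rewrite normrM.
have hm : `|G x 0 k - G zbar 0 k - m| <= TG x.
  have := norm_coord_le (G x - G zbar - (x - zbar) *m (Jac G x)^T) 0 k.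
  by rewrite -/(TG x) /m !mxE.
have hw : `|va G x 0 k| * `|G x 0 k - G zbar 0 k - m| <= 2 * TG x.
  by apply: ler_pM => //; rewrite vaE; exact: FBw_norm.
have hk' := le_trans hk (ler_wpM2r (sqr_ge0 _) (KC k)).
by apply: le_trans (lerD hk' hw) _; move: TH0; clear; lra.
Qed.

Lemma newton_residual_littleo e : 0 < e -> exists2 r : R, 0 < r &
  forall x, `|x - zbar| < r ->
  `|F x - (x - zbar) *m (DN x)^T| <= e * `|x - zbar|.
Proof.
move=> e0; have [C C0 [r r0 hC]] := newton_residual.
(* One quarter for the quadratic term, one for [TH], two for [2 * TG]. *)
have e4 : 0 < e / 4 by rewrite divr_gt0.
have [r1 r10 h1] := taylor_moving zbar HC e4.
have [r2 r20 h2] := taylor_moving zbar GC e4.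
have e5 : 0 < e / 4 / (C + 1) by rewrite !divr_gt0// ltr_wpDl.
exists (Num.min (Num.min r r1) (Num.min r2 (e / 4 / (C + 1)))).
  by rewrite !lt_min r0 r10 r20.
move=> x; rewrite !lt_min => /andP[/andP[/hC {}hC /h1 {}h1] /andP[/h2 {}h2 h5]].
apply: le_trans hC _; rewrite -/(TH x) in h1; rewrite -/(TG x) in h2.
have h3 : C * `|x - zbar| <= e / 4.
  move: h5; rewrite ltr_pdivlMr ?ltr_wpDl// => /ltW; apply: le_trans.
  by rewrite mulrDr mulr1 mulrC lerDl.
have n0 := normr_ge0 (x - zbar).
have h4 : C * `|x - zbar| ^+ 2 <= e / 4 * `|x - zbar|.
  by rewrite expr2 mulrA ler_wpM2r.
by lra.
Qed.

Lemma newton_residual_quadratic :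
  locally_lipschitz (Jac G) -> locally_lipschitz (Jac H) ->
  exists2 C : R, 0 <= C & exists2 r : R, 0 < r & forall x, `|x - zbar| < r ->
  `|F x - (x - zbar) *m (DN x)^T| <= C * `|x - zbar| ^+ 2.
Proof.
move=> GL HL; have [C C0 [r r0 hC]] := newton_residual.
have [K1 K10 [r1 r10 h1]] := taylor_lipschitz zbar HC HL.
have [K2 K20 [r2 r20 h2]] := taylor_lipschitz zbar GC GL.
exists (C + K1 + 2 * K2); first by rewrite !addr_ge0// mulr_ge0.
exists (Num.min r (Num.min r1 r2)); first by rewrite !lt_min r0 r10.
move=> x; rewrite !lt_min => /andP[/hC {}hC /andP[/h1 {}h1 /h2 {}h2]].
apply: le_trans hC _; rewrite -/(TH x) in h1; rewrite -/(TG x) in h2.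
by lra.
Qed.

(* Every limit point of the pairs [(va x, vb x)] as [x] tends to [zbar] is of this form. *)
Definition limit_weights (a b : 'rV[R]_p2) := forall i,
  (a 0 i - 1) ^+ 2 + (b 0 i - 1) ^+ 2 = 1 /\
  (i \notin I00 G zbar -> a 0 i = va G zbar 0 i /\ b 0 i = vb G zbar 0 i).

(** At an index outside [I00] of a solution exactly one argument of [phiFB] vanishes and the other
    is negative, where the weights are 0 for the negative argument and 1 for the vanishing one. *)
Lemma limit_weights_admissible a b : limit_weights a b -> admissible_ab G zbar a b.
Proof.
move=> hab; have [_ Gle xge _] := zbar_sol.
split=> i; rewrite inE.
- move=> Gi; have [_ _ G0] := phiFB_eq0 (phiFB_sol i).
  have x0 : - xi zbar 0 i = 0.
    by apply/eqP; move/eqP: G0; rewrite mulf_eq0 (lt_eqF Gi).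
  have [_ []] := hab i; first by rewrite !inE (lt_eqF Gi).
  by rewrite vaE vbE x0 => -> ->; exact: FBw_neg0.
- rewrite inE => /andP[/eqP Gi xi0]; have [_ []] := hab i.
    by rewrite !inE (gt_eqF xi0) andbF.
  rewrite vaE vbE Gi => -> ->.
  by have [-> ->] : FBw (- xi zbar 0 i) 0 = 0 /\ FBw 0 (- xi zbar 0 i) = 1
    by apply: FBw_neg0; rewrite oppr_lt0.
- by move=> _; exact: (hab i).1.
Qed.

(** At a solution every index lies in [Iminus], [Iplus] or [I00], and an admissible [a] vanishes on
    [Iminus], [b] on [Iplus]; so [Dhat_a] and [Dhat_b] are the diagonal matrices of [a] and [b]. *)
Lemma mulmx_qualification a b v : admissible_ab G zbar a b ->
  v *m (qualification_mx H G zbar a b)^T = FBlin (Jac H zbar) (Jac G zbar) a b v.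
Proof.
move=> [hm hp _]; rewrite -mulmx_block_tr /qualification_mx.
have [_ Gle xge _] := zbar_sol.
have diagE (c : 'rV[R]_p2) (I : {set 'I_p2}) :
    (forall i, i \notin I -> c 0 i = 0) -> diag_mx c *m Dset R I = diag_mx c.
  move=> hc; rewrite /Dset mul_diag_mx; apply/matrixP => i j; rewrite !mxE.
  have [->|_] := eqVneq i j; last by rewrite !mulr0n mulr0.
  rewrite !mulr1n; have [_|/hc ->] := boolP (j \in I); first by rewrite mulr1.
  by rewrite mul0r.
rewrite /Dhat_a /Dhat_b !diagE// => i; rewrite !inE negb_or !negb_and -?leNgt.
- rewrite leNgt; have [G0|Gn] := eqVneq (G zbar 0 i) 0.
    by rewrite G0 ltxx/= => x0; have [] := hp i; rewrite // !inE G0 eqxx lt_neqAle eq_sym x0 xge.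
  by rewrite lt_neqAle Gn Gle.
- have [G0|Gn] := eqVneq (G zbar 0 i) 0.
    rewrite /= => /andP[x0 xn]; move: (xge i); rewrite le_eqVlt eq_sym (negbTE xn)/=.
    by rewrite ltNge x0.
  by move=> _; have [] := hm i; rewrite // inE lt_neqAle Gn Gle.
Qed.

End local_analysis.

(** * Uniform injectivity *)

Section uniform_injectivity.
Context {R : realType} {p1 p2 q1 : nat}.
Variables (H : 'rV[R]_(p1 + p2) -> 'rV[R]_q1) (G : 'rV[R]_(p1 + p2) -> 'rV[R]_p2).
Local Notation p := (p1 + p2)%N.
Hypothesis HC : continuously_differentiable H.
Hypothesis GC : continuously_differentiable G.
Variable zbar : 'rV[R]_(p1 + p2).
Hypothesis zbar_sol : MNLCS H G zbar.
Hypothesis qualif : forall a b : 'rV[R]_p2, admissible_ab G zbar a b ->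
  independent_columns (qualification_mx H G zbar a b).

Let N a b v := FBlin (Jac H zbar) (Jac G zbar) a b v.

Lemma limit_injective a b v : limit_weights G zbar a b -> N a b v = 0 -> v = 0.
Proof.
move=> /(limit_weights_admissible zbar_sol) ab.
rewrite /N -(mulmx_qualification zbar_sol _ ab) => h.
by apply: (row_free_inj (qualif ab)); rewrite h mul0mx.
Qed.

(* A point [row_mx a (row_mx b v)] encodes the triple [(a, b, v)]. *)
Let pa (x : 'rV[R]_(p2 + (p2 + p))) : 'rV[R]_p2 := lsubmx x.
Let pb (x : 'rV[R]_(p2 + (p2 + p))) : 'rV[R]_p2 := lsubmx (rsubmx x).
Let pv (x : 'rV[R]_(p2 + (p2 + p))) : 'rV[R]_p := rsubmx (rsubmx x).

(** All constraints, limit weights and unit vector [v], as the zero set of one continuous function,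
    which makes the feasible set closed at once. *)
Let penalty x : R :=
  \sum_i ((pa x 0 i - 1) ^+ 2 + (pb x 0 i - 1) ^+ 2 - 1) ^+ 2
  + \sum_(i | i \notin I00 G zbar)
      ((pa x 0 i - va G zbar 0 i) ^+ 2 + (pb x 0 i - vb G zbar 0 i) ^+ 2)
  + (dotr (pv x) (pv x) - 1) ^+ 2.

Let penaltyP x : penalty x = 0 <->
  limit_weights G zbar (pa x) (pb x) /\ dotr (pv x) (pv x) = 1.
Proof.
rewrite /penalty; split=> [|[hw hv]].
  have t1 i : true -> 0 <= ((pa x 0 i - 1) ^+ 2 + (pb x 0 i - 1) ^+ 2 - 1) ^+ 2.
    by move=> _; exact: sqr_ge0.
  have t2 i : i \notin I00 G zbar -> 0 <=
      (pa x 0 i - va G zbar 0 i) ^+ 2 + (pb x 0 i - vb G zbar 0 i) ^+ 2.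
    by move=> _; rewrite addr_ge0 ?sqr_ge0.
  have := sumr_ge0 (index_enum _) t1; have := sumr_ge0 (index_enum _) t2.
  have := sqr_ge0 (dotr (pv x) (pv x) - 1).
  set S1 := \sum_i _; set S2 := \sum_(i | _) _; set S3 := _ ^+ 2.
  move=> s3 s2 s1 s0.
  have /psumr_eq0P z1 : S1 = 0 by lra.
  have /psumr_eq0P z2 : S2 = 0 by lra.
  have /eqP : S3 = 0 by lra.
  rewrite sqrf_eq0 subr_eq0 => /eqP ->; split=> // i; split=> [|hi].
    by apply/eqP; rewrite -subr_eq0 -sqrf_eq0; apply/eqP; exact: z1.
  have /eqP := z2 t2 i hi; rewrite paddr_eq0 ?sqr_ge0// !sqrf_eq0 !subr_eq0.
  by move=> /andP[/eqP -> /eqP ->].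
rewrite hv subrr expr0n addr0 !big1 ?addr0// => i hi.
  by have [_ /(_ hi)[-> ->]] := hw i; rewrite !subrr expr0n addr0.
by have [-> _] := hw i; rewrite subrr expr0n.
Qed.

Let pa_cont i : continuous (fun x => pa x 0 i).
Proof.
have -> : (fun x => pa x 0 i) = (fun x : 'rV[R]_(p2 + (p2 + p)) => x 0 (lshift _ i)).
  by apply/funext => x; rewrite mxE.
exact: coord_continuous.
Qed.

Let pb_cont i : continuous (fun x => pb x 0 i).
Proof.
have -> : (fun x => pb x 0 i) =
    (fun x : 'rV[R]_(p2 + (p2 + p)) => x 0 (rshift _ (lshift _ i))).
  by apply/funext => x; rewrite !mxE.
exact: coord_continuous.
Qed.

Let pv_cont : continuous pv.
Proof.
move=> x; apply: mx_continuous => i j; rewrite ord1.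
have -> : (fun x => pv x 0 j) =
    (fun x : 'rV[R]_(p2 + (p2 + p)) => x 0 (rshift _ (rshift _ j))).
  by apply/funext => y; rewrite !mxE.
exact: coord_continuous.
Qed.

Let dotr_cont (T : topologicalType) n (f : T -> 'rV[R]_n) x :
  {for x, continuous f} -> {for x, continuous (fun y => dotr (f y) (f y))}.
Proof.
by move=> cf; apply: sum_continuous => j _; apply: continuousM; exact: coord_continuous_for.
Qed.

Let sqr_cont (T : topologicalType) (f : T -> R) x :
  {for x, continuous f} -> {for x, continuous (fun y => f y ^+ 2)}.
Proof. by move=> cf; apply: continuousM. Qed.

Let subc_cont (T : topologicalType) (f : T -> R) (c : R) x :
  {for x, continuous f} -> {for x, continuous (fun y => f y - c)}.
Proof. by move=> cf; apply: continuousB => //; exact: cvg_cst. Qed.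

Let penalty_cont : continuous penalty.
Proof.
move=> x.
have c1 : {for x, continuous (fun y =>
    \sum_i ((pa y 0 i - 1) ^+ 2 + (pb y 0 i - 1) ^+ 2 - 1) ^+ 2)}.
  apply: sum_continuous => i _; apply: sqr_cont; apply: subc_cont.
  by apply: continuousD; apply: sqr_cont; apply: subc_cont;
    [exact: pa_cont|exact: pb_cont].
have c2 : {for x, continuous (fun y => \sum_(i | i \notin I00 G zbar)
    ((pa y 0 i - va G zbar 0 i) ^+ 2 + (pb y 0 i - vb G zbar 0 i) ^+ 2))}.
  apply: sum_continuous => i _.
  by apply: continuousD; apply: sqr_cont; apply: subc_cont;
    [exact: pa_cont|exact: pb_cont].
have c3 : {for x, continuous (fun y => (dotr (pv y) (pv y) - 1) ^+ 2)}.
  by apply: sqr_cont; apply: subc_cont; apply: dotr_cont; exact: pv_cont.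
exact: (cvgD (cvgD c1 c2) c3).
Qed.

Let objective_cont : continuous (fun x =>
  dotr (N (pa x) (pb x) (pv x)) (N (pa x) (pb x) (pv x))).
Proof.
move=> x; apply: (@dotr_cont _ _ (fun x => N (pa x) (pb x) (pv x))); apply: mx_continuous => u j.
rewrite ord1 -[j]splitK; case: (fintype.split j) => k /=.
  have -> : (fun y => N (pa y) (pb y) (pv y) 0 (lshift p2 k)) =
      (fun y => (pv y *m (Jac H zbar)^T) 0 k).
    by apply/funext => y; rewrite /N FBlinEl.
  apply: coord_continuous_for; apply: mulmx_continuous; first exact: pv_cont.
  by apply: cst_continuous.
have -> : (fun y => N (pa y) (pb y) (pv y) 0 (rshift q1 k)) =
    (fun y => pa y 0 k * (pv y *m (Jac G zbar)^T) 0 k - pb y 0 k * pv y 0 (rshift p1 k)).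
  by apply/funext => y; rewrite /N FBlinEr [rsubmx _ _ _]mxE.
apply: continuousB; apply: continuousM; [exact: pa_cont| |exact: pb_cont|].
  apply: coord_continuous_for; apply: mulmx_continuous; first exact: pv_cont.
  by apply: cst_continuous.
by apply: coord_continuous_for; exact: pv_cont.
Qed.

Let feasible_compact : compact [set x | penalty x = 0].
Proof.
apply: bounded_closed_compact.
  (* The circles confine the weights to the interval from 0 to 2 and the coordinates of a unit
     vector are at most 1 in absolute value. *)
  exists 3; split; first by rewrite num_real.
  move=> M M3 x /penaltyP[hw hv]; apply: norm_mx_le => [|u j].
    by apply: ltW; apply: lt_trans M3.
  have sqr_le (s t : R) : (s - 1) ^+ 2 + t ^+ 2 = 1 -> `|s| <= 3.
    move=> st; have : `|s - 1| <= 1.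
      rewrite -(@expr_le1 _ 2)// real_normK ?num_real//.
      by have := sqr_ge0 t; lra.
    by rewrite !ler_norml => /andP[? ?]; apply/andP; split; lra.
  apply: le_trans (ltW M3).
  rewrite ord1 -[j]splitK; case: (fintype.split j) => k /=.
    have -> : x 0 (lshift (p2 + p) k) = pa x 0 k by rewrite mxE.
    by have [h _] := hw k; exact: sqr_le h.
  rewrite -[k]splitK; case: (fintype.split k) => l /=.
    have -> : x 0 (rshift p2 (lshift p l)) = pb x 0 l by rewrite !mxE.
    by have [h _] := hw l; rewrite addrC in h; exact: sqr_le h.
  have -> : x 0 (rshift p2 (rshift p2 l)) = pv x 0 l by rewrite !mxE.
  apply: le_trans (norm_coord_le _ _ _) _; apply: le_trans (norm_le_enorm _) _.
  by rewrite enormE hv sqrtr1 ler1n.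
have -> : [set x | penalty x = 0] = penalty @^-1` [set 0] by [].
apply: preimage_closed => [x _|]; [exact: penalty_cont|exact: closed_eq].
Qed.

(** The norm of the image attains its minimum on the compact feasible set, where injectivity makes
    it positive; homogeneity in [v] extends the bound from unit vectors. *)
Lemma limit_injective_uniform : exists2 c : R, 0 < c &
  forall a b v, limit_weights G zbar a b -> c * enorm v <= enorm (N a b v).
Proof.
have NZ a b v t : N a b (t *: v) = t *: N a b v.
  apply/rowP => j; rewrite [RHS]mxE -[j]splitK; case: (fintype.split j) => k /=.
    by rewrite /N !FBlinEl -scalemxAl mxE.
  by rewrite /N !FBlinEr -scalemxAl !mxE; ring.
have scaling a b v (c : R) : 0 <= c ->
    (forall u, dotr u u = 1 -> c <= enorm (N a b u)) -> c * enorm v <= enorm (N a b v).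
  move=> c0 hc; have [/enorm_eq0 ->|vn0] := eqVneq (enorm v) 0.
    by rewrite enorm0 mulr0 enorm_ge0.
  have v0 : 0 < enorm v by rewrite lt_neqAle eq_sym vn0 enorm_ge0.
  have := hc ((enorm v)^-1 *: v); rewrite -enorm_sqr enormZ NZ enormZ.
  rewrite ger0_norm ?invr_ge0 ?enorm_ge0// mulVf// expr1n => /(_ erefl).
  by rewrite mulrC ler_pdivlMr.
have [[x0 x0K]|K0] := pselect ([set x | penalty x = 0] !=set0); last first.
  (* With no feasible point there is no unit vector to pair with the limit weights [a] and [b], so
     any constant will do. *)
  exists 1 => // a b v hab; apply: scaling => // u u1.
  exfalso; apply: K0; exists (row_mx a (row_mx b u)); apply/penaltyP.
  by rewrite /pa /pb /pv !(row_mxKl, row_mxKr).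
have := compact_EVT_min (ex_intro _ x0 x0K) feasible_compact
  (continuous_subspaceT objective_cont).
move=> [xm /[1!inE] xmK hmin].
exists (enorm (N (pa xm) (pb xm) (pv xm))).
  rewrite lt_neqAle enorm_ge0 andbT eq_sym; apply/eqP => /enorm_eq0 h.
  have /penaltyP[hw hv] := xmK.
  by move: hv; rewrite (limit_injective hw h) -enorm_sqr enorm0 expr0n => /eqP;
    rewrite eq_sym oner_eq0.
move=> a b v hab; apply: scaling => [|u u1]; first exact: enorm_ge0.
rewrite !enormE ler_wsqrtr//.
have := hmin (row_mx a (row_mx b u)); rewrite inE /pa /pb /pv !(row_mxKl, row_mxKr).
apply; apply/penaltyP; by rewrite /pa /pb /pv !(row_mxKl, row_mxKr).
Qed.

End uniform_injectivity.

(** * A single Levenberg-Marquardt step near a solution *)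

Section local_convergence.
Context {R : realType} {p1 p2 q1 : nat}.
Variables (H : 'rV[R]_(p1 + p2) -> 'rV[R]_q1) (G : 'rV[R]_(p1 + p2) -> 'rV[R]_p2).
Variables (gamma1 gamma2 : R).
Local Notation p := (p1 + p2)%N.
Local Notation F := (FFB H G).
Local Notation DN := (DNFFB H G).
Local Notation nu := (LM_nu H G gamma1 gamma2).
Local Notation xi := rsubmx.
Hypothesis HC : continuously_differentiable H.
Hypothesis GC : continuously_differentiable G.
Hypothesis gamma1_gt0 : 0 < gamma1.
Hypothesis gamma2_gt0 : 0 < gamma2.
Variable zbar : 'rV[R]_(p1 + p2).
Hypothesis zbar_sol : MNLCS H G zbar.
Hypothesis qualif : forall a b : 'rV[R]_p2, admissible_ab G zbar a b ->
  independent_columns (qualification_mx H G zbar a b).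

(** The witnesses copy the weights of [x] on [I00 G zbar], where they lie on the circle anyway, and
    those of [zbar] elsewhere, where [FBw] is continuous. *)
Lemma DN_weights_near e : 0 < e -> exists2 r : R, 0 < r &
  forall x, `|x - zbar| < r -> exists a b, [/\ limit_weights G zbar a b,
    `|va G x - a| <= e & `|vb G x - b| <= e].
Proof.
move=> e0; have [L L0 [r r0 hL]] := FB_args_near GC zbar.
have hi i : exists2 r : R, 0 < r & forall x, `|x - zbar| < r ->
    i \notin I00 G zbar ->
    `|va G x 0 i - va G zbar 0 i| <= e /\ `|vb G x 0 i - vb G zbar 0 i| <= e.
  have [iI|iI] := boolP (i \in I00 G zbar); first by exists 1.
  have h0 : 0 < hyp (G zbar 0 i) (- xi zbar 0 i).
    by move: iI; rewrite hyp_gt0 !inE oppr_eq0.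
  have h0' : 0 < hyp (- xi zbar 0 i) (G zbar 0 i) by rewrite hypC.
  have [r1 r10 h1] := FBw_near h0 e0; have [r2 r20 h2] := FBw_near h0' e0.
  have L1 : 0 < L + 1 by rewrite ltr_wpDl.
  exists (Num.min r (Num.min r1 r2 / (L + 1))).
    by rewrite lt_min r0 divr_gt0// lt_min r10.
  move=> x; rewrite lt_min => /andP[/(hL x i) hx hxr] _.
  have : L * `|x - zbar| < Num.min r1 r2.
    move: hxr; rewrite ltr_pdivlMr//; apply: le_lt_trans.
    by rewrite mulrDr mulr1 mulrC lerDl.
  rewrite lt_min => /andP[/(le_lt_trans hx) hr1 /(le_lt_trans hx) hr2].
  by rewrite !vaE !vbE; split; [exact: h1|apply: h2; rewrite addrC].
have [r' r'0 hr'] := near_forall_ord hi; exists r' => // x /hr' {}hr'.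
exists (\row_i (if i \in I00 G zbar then va G x 0 i else va G zbar 0 i)).
exists (\row_i (if i \in I00 G zbar then vb G x 0 i else vb G zbar 0 i)).
split.
- move=> i; rewrite [X in (X - 1) ^+ 2 + _]mxE [X in _ + (X - 1) ^+ 2]mxE; split.
    by case: ifP => _; rewrite vaE vbE FBw_circle.
  by move=> iI; rewrite !mxE (negbTE iI).
- apply: norm_mx_le => [|u i]; first exact: ltW.
  rewrite ord1 mxE [X in _ + X]mxE [X in _ - X]mxE; case: ifP => [_|/negbT iI].
    by rewrite subrr normr0 ltW.
  by have [] := hr' i iI.
- apply: norm_mx_le => [|u i]; first exact: ltW.
  rewrite ord1 mxE [X in _ + X]mxE [X in _ - X]mxE; case: ifP => [_|/negbT iI].
    by rewrite subrr normr0 ltW.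
  by have [] := hr' i iI.
Qed.

Lemma DN_injective_near : exists2 c : R, 0 < c & exists2 r : R, 0 < r &
  forall x v, `|x - zbar| < r -> c * enorm v <= enorm (v *m (DN x)^T).
Proof.
have [c c0 hc] := limit_injective_uniform zbar_sol qualif.
have ar (t u v w : R) : c * t <= u -> v <= c / 2 * t -> u - v <= w -> c / 2 * t <= w.
  by lra.
(* The coefficients in [norm_FBlinB] when all four differences are at most [e]; [e] is then chosen
   so that the Euclidean perturbation uses up half of [c]. *)
pose S : R := p%:R + p%:R * 2 + p%:R * `|Jac G zbar| + 1.
have S0 : 0 < S by rewrite ltr_wpDl// !addr_ge0 ?mulr_ge0.
pose e := c / 2 / ((q1 + p2)%:R + 1) / S.
have m0 : 0 < (q1 + p2)%:R + 1 :> R by rewrite ltr_wpDl.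
have e0 : 0 < e by rewrite !divr_gt0.
have [r1 r10 h1] := Jac_near zbar HC e0; have [r2 r20 h2] := Jac_near zbar GC e0.
have [r3 r30 h3] := DN_weights_near e0.
exists (c / 2); first by rewrite divr_gt0.
exists (Num.min r1 (Num.min r2 r3)); first by rewrite !lt_min r10 r20.
move=> x v; rewrite !lt_min => /andP[/h1/ltW {}h1 /andP[/h2/ltW {}h2 /h3 {}h3]].
have [a [b [hab ha hb]]] := h3.
rewrite mulmx_DN.
pose y := FBlin (Jac H zbar) (Jac G zbar) a b v.
pose w := FBlin (Jac H x) (Jac G x) (va G x) (vb G x) v.
have hy : c * enorm v <= enorm y by exact: hc.
suff : c / 2 * enorm v <= enorm w by [].
have hd : `|w - y| <= S * e * `|v|.
  apply: le_trans (norm_FBlinB _ _ _ _ _ _ _ _ _) _; rewrite ler_wpM2r//.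
  rewrite /S !mulrDl mul1r; apply: lerD; last exact: hb.
  apply: lerD; last by rewrite ler_wpM2l ?mulr_ge0.
  apply: lerD; first by rewrite ler_wpM2l.
  rewrite -!mulrA ler_wpM2l// mulrC ler_pM// norm_va//.
have he : enorm (w - y) <= c / 2 * enorm v.
  apply: le_trans (enorm_le _) _.
  apply: le_trans (ler_wpM2l _ hd) _; first by rewrite ler0n.
  have -> : S * e = c / 2 / ((q1 + p2)%:R + 1) by rewrite /e mulrC divfK// gt_eqF.
  rewrite mulrA ler_pM ?norm_le_enorm//; first by rewrite mulr_ge0 ?divr_ge0 ?(ltW c0) ?(ltW m0).
  by rewrite mulrCA ler_piMr ?divr_ge0 ?(ltW c0)// ler_pdivrMr// mul1r lerDl.
have := enormBl y (y - w); rewrite subKr -(enormN (y - w)) opprB.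
exact: (ar _ _ _ _ hy he).
Qed.

Lemma enorm_FFB_le : exists2 K : R, 0 <= K & exists2 r : R, 0 < r &
  forall x, `|x - zbar| < r -> enorm (F x) <= K * enorm (x - zbar).
Proof.
have [K K0 [r r0 hK]] := FFB_calm HC GC zbar.
exists ((q1 + p2)%:R * K); first by rewrite mulr_ge0.
exists r => // x /hK; rewrite (FFB_sol zbar_sol) subr0 => h.
apply: le_trans (enorm_le _) _; rewrite -mulrA ler_wpM2l//.
by apply: le_trans h _; rewrite ler_wpM2l// norm_le_enorm.
Qed.

(* With [e = x - zbar] and the residual [r = F x - e D^T], the Levenberg-Marquardt
   system reads [(e + d)(D^T D + nu) = nu e - r D]; test it with [e + d]. *)
Lemma LM_step_error c x d : 0 < c ->
  (forall v, c * enorm v <= enorm (v *m (DN x)^T)) ->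
  LM_system H G gamma1 gamma2 x d ->
  c ^+ 2 * enorm (x + d - zbar) <= nu x * enorm (x - zbar) +
    c * enorm (F x - (x - zbar) *m (DN x)^T).
Proof.
move=> c0 hc /(LM_system_row) hd.
set e := x - zbar. set A := (DN x)^T in hc hd *; set r := F x - e *m A.
have -> : x + d - zbar = e + d by rewrite addrAC.
clearbody e.
have DA : DN x = A^T by rewrite trmxK.
set s := e + d.
have sE : (s *m A) *m A^T + nu x *: s = nu x *: e - r *m A^T.
  have -> : s *m A *m A^T = e *m A *m A^T + d *m A *m A^T by rewrite /s !mulmxDl.
  rewrite -DA in hd *; rewrite scalerDr addrACA hd grad_Psi// /r mulmxBl opprB.
  by rewrite [RHS]addrCA addrA.
have n0 := LM_nu_ge0 H G gamma1_gt0 gamma2_gt0 x.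
have := congr1 (fun u => dotr u s) sE.
rewrite dotrDl dotrBl !dotrZl (dotr_mulmx (s *m A)) (dotr_mulmx r) trmxK -!enorm_sqr => dE.
have h1 := cauchy_schwarz e s.
have h2 := cauchy_schwarz (- r) (s *m A).
rewrite enormN dotrNl in h2.
have hS := hc s.
have S0 := enorm_ge0 s; have E0 := enorm_ge0 e; have R0 := enorm_ge0 r.
have SA0 := enorm_ge0 (s *m A).
move: h1 h2 hS S0 E0 R0 SA0 dE n0.
move: (dotr e s) (dotr r _) (enorm s) (enorm e) (enorm r) (enorm (s *m A)) (nu x).
move=> es rs S E r' T n h1 h2 hS S0 E0 R0 T0 dE n0.
(* The term [n * S ^+ 2] on the left is dropped. With [c * S <= T] on both sides this gives the
   claim multiplied by [T], which is why [T = 0] is treated apart. *)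
have h3 : T ^+ 2 <= n * E * S + r' * T.
  have : n * es <= n * (E * S) by rewrite ler_wpM2l.
  have : 0 <= n * S ^+ 2 by rewrite mulr_ge0 ?sqr_ge0.
  by lra.
have [T00|T00] := eqVneq T 0.
  have cS : c * S <= 0 by rewrite -T00.
  have : c ^+ 2 * S <= 0 by rewrite expr2 -mulrA pmulr_rle0.
  by move=> /le_trans; apply; rewrite addr_ge0 ?mulr_ge0// ltW.
have Tgt0 : 0 < T by rewrite lt_neqAle eq_sym T00.
rewrite -(ler_pM2r Tgt0).
have h4 : c * S * (c * T) <= T * (c * T).
  by rewrite ler_wpM2r// mulr_ge0// ltW.
have h5 : c * T ^+ 2 <= c * (n * E * S + r' * T) by rewrite ler_pM2l.
have h6 : n * E * (c * S) <= n * E * T by rewrite ler_wpM2l// mulr_ge0.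
by lra.
Qed.

End local_convergence.

(** * Local convergence *)

Section convergence.
Context {R : realType} {p1 p2 q1 : nat}.
Variables (H : 'rV[R]_(p1 + p2) -> 'rV[R]_q1) (G : 'rV[R]_(p1 + p2) -> 'rV[R]_p2).
Variables (kappa tau_abs sigma beta rho gamma1 gamma2 : R).
Local Notation p := (p1 + p2)%N.
Local Notation F := (FFB H G).
Local Notation DN := (DNFFB H G).
Local Notation nu := (LM_nu H G gamma1 gamma2).
Hypothesis HC : continuously_differentiable H.
Hypothesis GC : continuously_differentiable G.
Hypothesis kappa01 : 0 < kappa < 1.
Hypothesis gamma1_gt0 : 0 < gamma1.
Hypothesis gamma2_gt0 : 0 < gamma2.
Variable zbar : 'rV[R]_(p1 + p2).
Hypothesis zbar_sol : MNLCS H G zbar.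
Hypothesis qualif : forall a b : 'rV[R]_p2, admissible_ab G zbar a b ->
  independent_columns (qualification_mx H G zbar a b).

Lemma LM_nu_le K x : enorm (F x) <= K * enorm (x - zbar) ->
  nu x <= gamma2 * K * enorm (x - zbar).
Proof.
move=> h; apply: (@le_trans _ _ (gamma2 * enorm (F x))).
  by rewrite ge_min lexx orbT.
by rewrite -mulrA ler_wpM2l// ltW.
Qed.

Lemma newton_residual_enorm eps : 0 < eps -> exists2 r : R, 0 < r &
  forall x, `|x - zbar| < r ->
  enorm (F x - (x - zbar) *m (DN x)^T) <= eps * enorm (x - zbar).
Proof.
move=> e0; have m0 : 0 < (q1 + p2)%:R + 1 :> R by rewrite ltr_wpDl.
have e1 : 0 < eps / ((q1 + p2)%:R + 1) by rewrite divr_gt0.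
have [r r0 hr] := newton_residual_littleo HC GC zbar_sol e1.
exists r => // x /hr h; apply: le_trans (enorm_le _) _.
apply: le_trans (ler_wpM2l _ h) _; first by rewrite ler0n.
rewrite mulrA; apply: ler_pM => //; last exact: norm_le_enorm.
  by rewrite mulr_ge0// ltW.
by rewrite mulrCA ler_piMr ?(ltW e0)// ler_pdivrMr// mul1r lerDl.
Qed.

(** The test of step 2 passes because [F] is at least of size [c / 2] times the old distance at [x],
    and at [x + d] at most [K] times the new one. The free factor [eta] is used as 1/2 for
    convergence, as an arbitrary number for the superlinear rate, and as 1 just to know that the
    full step is taken. *)
Lemma LM_local_step eta : 0 < eta -> exists2 r : R, 0 < r & forall x d x',
  enorm (x - zbar) < r -> LM_system H G gamma1 gamma2 x d ->
  LM_update H G kappa sigma beta rho x d x' ->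
  enorm (x' - zbar) <= eta * enorm (x - zbar) /\ x' = x + d.
Proof.
move=> eta0; have /andP[k0 k1] := kappa01.
have [c c0 [r1 r10 h1]] := DN_injective_near HC GC zbar_sol qualif.
have [K K0 [r2 r20 h2]] := enorm_FFB_le HC GC zbar_sol.
have K1 : 0 < K + 1 by rewrite ltr_wpDl.
(* The bound 1 keeps [x + d] in the ball where [enorm_FFB_le] applies; the last one ensures
   [K * eta' <= kappa * (c / 2)]. *)
pose eta' := Num.min eta (Num.min 1 (kappa * c / 2 / (K + 1))).
have eta'0 : 0 < eta'.
  by rewrite !lt_min eta0 ltr01 divr_gt0// divr_gt0// mulr_gt0.
have eta'1 : eta' <= 1 by rewrite !ge_min lexx orbT.
have eta'K : K * eta' <= kappa * (c / 2).
  have : eta' <= kappa * c / 2 / (K + 1) by rewrite !ge_min lexx !orbT.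
  by rewrite ler_pdivlMr//; move: (ltW eta'0); nra.
(* The first bound yields the lower estimate of [F x]. The second spends half of the error budget
   [c ^+ 2 * eta'] on the residual; [r4] spends the other half on [nu]. *)
pose eps := Num.min (c / 2) (c * eta' / 2).
have eps0 : 0 < eps by rewrite lt_min !divr_gt0// mulr_gt0.
have epsc : eps <= c / 2 by rewrite ge_min lexx.
have epsE : eps <= c * eta' / 2 by rewrite ge_min lexx orbT.
have [r3 r30 h3] := newton_residual_enorm eps0.
have gK : 0 < gamma2 * K + 1 by rewrite ltr_wpDl// mulr_ge0// ltW.
pose r4 := c ^+ 2 * eta' / 2 / (gamma2 * K + 1).
have r40 : 0 < r4 by rewrite !divr_gt0// mulr_gt0// exprn_gt0.
exists (Num.min (Num.min r1 r2) (Num.min r3 r4)).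
  by rewrite !lt_min r10 r20 r30.
move=> x d x'; rewrite !lt_min => /andP[/andP[xr1 xr2] /andP[xr3 xr4]] hd hu.
have nle := norm_le_enorm (x - zbar).
have {}h1 v := h1 x v (le_lt_trans nle xr1).
have {}h3 := h3 x (le_lt_trans nle xr3).
have Fx := h2 x (le_lt_trans nle xr2).
have hs := LM_step_error HC GC gamma1_gt0 gamma2_gt0 zbar c0 h1 hd.
have hn := LM_nu_le Fx.
have E0 := enorm_ge0 (x - zbar).
have s_le : enorm (x + d - zbar) <= eta' * enorm (x - zbar).
  rewrite -(ler_pM2l (exprn_gt0 2 c0)); apply: le_trans hs _.
  have b1 : nu x * enorm (x - zbar) <= c ^+ 2 * eta' / 2 * enorm (x - zbar).
    apply: ler_wpM2r => //; apply: le_trans hn _.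
    move: xr4; rewrite /r4 ltr_pdivlMr// => /ltW; apply: le_trans.
    by rewrite mulrDr mulr1 mulrC lerDl.
  have b2 : c * enorm (F x - (x - zbar) *m (DN x)^T) <=
      c * (c * eta' / 2 * enorm (x - zbar)).
    rewrite ler_pM2l//; apply: le_trans h3 _; exact: ler_wpM2r.
  apply: le_trans (lerD b1 b2) _.
  by rewrite le_eqVlt; apply/orP; left; apply/eqP; field.
have Fxd : enorm (F (x + d)) <= K * enorm (x + d - zbar).
  apply: h2; apply: le_lt_trans (norm_le_enorm _) _; apply: le_lt_trans s_le _.
  by apply: le_lt_trans xr2; rewrite ler_piMl.
have Flow : c / 2 * enorm (x - zbar) <= enorm (F x).
  have := h1 (x - zbar).
  have := enormBl ((x - zbar) *m (DN x)^T) ((x - zbar) *m (DN x)^T - F x).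
  rewrite subKr -(enormN (_ - F x)) opprB.
  move: h3 (ler_wpM2r E0 epsc).
  move: (enorm (F x - _)) (enorm (_ *m _)) (enorm (F x)) (enorm (x - zbar)).
  by move=> a b f t; lra.
have ratio : enorm (F (x + d)) <= kappa * enorm (F x).
  apply: le_trans Fxd _; apply: (@le_trans _ _ (K * (eta' * enorm (x - zbar)))).
    exact: ler_wpM2l.
  rewrite mulrA; apply: le_trans (ler_wpM2r E0 eta'K) _.
  by rewrite -mulrA ler_pM2l.
(* The test compares squares, so [ratio] gives the factor [kappa ^+ 2], which is at most [kappa]. *)
have test : LM_test H G kappa x d.
  rewrite /LM_test /PsiFB [leRHS]mulrCA ler_pM2l ?invr_gt0//.
  apply: (@le_trans _ _ ((kappa * enorm (F x)) ^+ 2)).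
    by rewrite lerXn2r ?nnegrE ?enorm_ge0// mulr_ge0 ?enorm_ge0// ltW.
  rewrite exprMn ler_wpM2r ?sqr_ge0// expr2 ler_piMr// ltW//.
move: hu; rewrite /LM_update test => ->; split=> //.
by apply: le_trans s_le _; rewrite ler_wpM2r// ge_min lexx.
Qed.

(** Since [nu] is bounded by a multiple of the residual norm, it is of the order of the distance to
    [zbar], so the regularisation error [nu x * enorm (x - zbar)] is quadratic like the Newton
    residual. *)
Lemma LM_quadratic_step :
  locally_lipschitz (Jac G) -> locally_lipschitz (Jac H) ->
  exists2 C : R, 0 < C & exists2 r : R, 0 < r & forall x d,
  enorm (x - zbar) < r -> LM_system H G gamma1 gamma2 x d ->
  enorm (x + d - zbar) <= C * enorm (x - zbar) ^+ 2.
Proof.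
move=> GL HL.
have [c c0 [r1 r10 h1]] := DN_injective_near HC GC zbar_sol qualif.
have [K K0 [r2 r20 h2]] := enorm_FFB_le HC GC zbar_sol.
have [M M0 [r3 r30 h3]] := newton_residual_quadratic HC GC zbar_sol GL HL.
pose C := (gamma2 * K + c * ((q1 + p2)%:R * M)) / c ^+ 2.
have C0 : 0 <= C.
  by rewrite divr_ge0 ?sqr_ge0// addr_ge0 ?mulr_ge0// ltW.
exists (C + 1); first by rewrite ltr_wpDl.
exists (Num.min r1 (Num.min r2 r3)); first by rewrite !lt_min r10 r20.
move=> x d; rewrite !lt_min => /andP[xr1 /andP[xr2 xr3]] hd.
have nle := norm_le_enorm (x - zbar).
have {}h1 v := h1 x v (le_lt_trans nle xr1).
have {}h3 := h3 x (le_lt_trans nle xr3).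
have Fx := h2 x (le_lt_trans nle xr2).
have hs := LM_step_error HC GC gamma1_gt0 gamma2_gt0 zbar c0 h1 hd.
have hn := LM_nu_le Fx.
have E0 := enorm_ge0 (x - zbar).
apply: (@le_trans _ _ (C * enorm (x - zbar) ^+ 2)); last first.
  by rewrite ler_wpM2r ?sqr_ge0// lerDl.
rewrite -(ler_pM2l (exprn_gt0 2 c0)); apply: le_trans hs _.
have b1 : nu x * enorm (x - zbar) <= gamma2 * K * enorm (x - zbar) * enorm (x - zbar).
  exact: ler_wpM2r.
have b2 : enorm (F x - (x - zbar) *m (DN x)^T) <=
    (q1 + p2)%:R * (M * enorm (x - zbar) ^+ 2).
  apply: le_trans (enorm_le _) _; apply: ler_wpM2l; first by rewrite ler0n.
  apply: le_trans h3 _; apply: ler_wpM2l => //.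
  by rewrite lerXn2r ?nnegrE.
apply: le_trans (lerD b1 (ler_wpM2l (ltW c0) b2)) _.
rewrite le_eqVlt; apply/orP; left; apply/eqP; rewrite /C; field.
by rewrite gt_eqF.
Qed.

Variables (z d : nat -> 'rV[R]_(p1 + p2)).
Hypothesis zd_gen : LM_generated H G kappa tau_abs sigma beta rho gamma1 gamma2 z d.
Hypothesis zbar_acc : accumulation_point z zbar.

Lemma accumulation_point_enorm_near (r : R) : 0 < r ->
  exists k, enorm (z k - zbar) < r.
Proof.
move=> r0; have p0 : 0 < p%:R + 1 :> R by rewrite ltr_wpDl.
have r0' : 0 < r / (p%:R + 1) by rewrite divr_gt0.
have [k _ hk] := accumulation_point_near 0 zbar_acc r0'; exists k.
apply: le_lt_trans (enorm_le _) _; move: hk; rewrite ltr_pdivlMr//.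
by apply: le_lt_trans; rewrite mulrDr mulr1 mulrC lerDl.
Qed.

Lemma iterates_cvg : z @ \oo --> zbar.
Proof.
have half0 : 0 < 2^-1 :> R by rewrite invr_gt0.
have [r r0 hr] := LM_local_step half0.
have [k0 hk0] := accumulation_point_enorm_near r0.
have decay j : enorm (z (k0 + j)%N - zbar) <= r * 2^-1 ^+ j.
  elim: j => [|j IH]; first by rewrite addn0 expr0 mulr1 ltW.
  rewrite addnS; have [_ [ld _] lu] := zd_gen (k0 + j)%N.
  (* Strictness comes from the choice of [k0] if [j = 0] and from [2^-1 ^+ j < 1] afterwards. *)
  have hlt : enorm (z (k0 + j)%N - zbar) < r.
    case: (j) IH => [|j' IH]; first by rewrite addn0.
    apply: le_lt_trans IH _; rewrite gtr_pMr// exprn_ilt1//.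
    by rewrite invf_lt1// ltr1n.
  have [h _] := hr _ _ _ hlt ld lu.
  by apply: le_trans h _; rewrite exprS mulrCA ler_pM2l.
apply/cvgrPdist_lt => e e0.
have : geometric r 2^-1 @ \oo --> (0 : R).
  by apply: cvg_geometric; rewrite ger0_norm ?invf_lt1 ?ltr1n// ltW.
move=> /cvgrPdist_lt/(_ e e0)[N _ hN]; exists (k0 + N)%N => // k /= hk.
rewrite distrC; apply: le_lt_trans (norm_le_enorm _) _.
have kE : (k0 + (k - k0))%N = k by rewrite subnKC// (leq_trans _ hk)// leq_addr.
rewrite -kE; apply: le_lt_trans (decay _) _.
have := hN (k - k0)%N; rewrite /= sub0r normrN ger0_norm.
  by apply; rewrite leq_subRL// (leq_trans _ hk)// leq_addr.
by rewrite mulr_ge0 ?exprn_ge0 ?ltW.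
Qed.

Lemma iterates_enorm_near (r : R) : 0 < r -> \forall k \near \oo, enorm (z k - zbar) < r.
Proof.
move=> r0; have p0 : 0 < p%:R + 1 :> R by rewrite ltr_wpDl.
have r0' : 0 < r / (p%:R + 1) by rewrite divr_gt0.
have /cvgrPdist_lt/(_ _ r0') := iterates_cvg; apply: filterS => k.
rewrite distrC ltr_pdivlMr// => hk; apply: le_lt_trans (enorm_le _) _.
by apply: le_lt_trans hk; rewrite mulrDr mulr1 mulrC lerDl.
Qed.

Lemma iterates_superlinear : superlinear_convergence z zbar.
Proof.
split; first exact: iterates_cvg.
apply/eqoP => e e0; have [r r0 hr] := LM_local_step e0.
have := iterates_enorm_near r0; apply: filterS => k hk.
have [_ [ld _] lu] := zd_gen k; have [h _] := hr _ _ _ hk ld lu.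
by rewrite !ger0_norm ?enorm_ge0.
Qed.

Lemma iterates_quadratic :
  locally_lipschitz (Jac G) -> locally_lipschitz (Jac H) ->
  quadratic_convergence z zbar.
Proof.
move=> GL HL; split; first exact: iterates_cvg.
have [C C0 [r r0 hr]] := LM_quadratic_step GL HL.
have [r' r'0 hr'] := LM_local_step ltr01.
apply/eqO_exP; exists C => //.
have h1 := iterates_enorm_near r0; have h2 := iterates_enorm_near r'0.
near=> k.
have hk : enorm (z k - zbar) < r by near: k.
have hk' : enorm (z k - zbar) < r' by near: k.
have [_ [ld _] lu] := zd_gen k; have [_ zE] := hr' _ _ _ hk' ld lu.
rewrite !ger0_norm ?enorm_ge0 ?sqr_ge0// zE; exact: hr.
Unshelve. all: by end_near. Qed.

End convergence.

Theorem theorem4p12 (R : realType) (p1 p2 q1 : nat)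
  (H : 'rV[R]_(p1 + p2) -> 'rV[R]_q1) (G : 'rV[R]_(p1 + p2) -> 'rV[R]_p2)
  (kappa tau_abs sigma beta rho gamma1 gamma2 : R)
  (z d : nat -> 'rV[R]_(p1 + p2))
  (H_C1 : continuously_differentiable H)
  (G_C1 : continuously_differentiable G)
  (kappa01 : 0 < kappa < 1) (tau_abs_ge0 : 0 <= tau_abs)
  (sigma01 : 0 < sigma < 1) (beta01 : 0 < beta < 1)
  (rho_gt0 : 0 < rho) (gamma1_gt0 : 0 < gamma1) (gamma2_gt0 : 0 < gamma2)
  (zd_gen : LM_generated H G kappa tau_abs sigma beta rho gamma1 gamma2 z d) :
  [/\ infinite_set [set k : nat | LM_test H G kappa (z k) (d k)] ->
      (PsiFB H G (z k) @[k --> \oo] --> (0 : R)) /\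
      (forall zbar, accumulation_point z zbar -> MNLCS H G zbar),
      forall zbar, accumulation_point z zbar -> stationary (PsiFB H G) zbar
    & forall zbar, accumulation_point z zbar -> MNLCS H G zbar ->
      (forall a b : 'rV[R]_p2, admissible_ab G zbar a b ->
         independent_columns (qualification_mx H G zbar a b)) ->
      superlinear_convergence z zbar /\
      (locally_lipschitz (Jac G) -> locally_lipschitz (Jac H) ->
       quadratic_convergence z zbar)].
Proof.
split=> [tinf|zbar acc|zbar acc sol qualif].
- have cv0 := Psi_iterates_cvg0 H_C1 G_C1 kappa01 sigma01 beta01 rho_gt0 zd_gen tinf.
  split=> // zbar; exact: accumulation_point_solution.
- exact: (accumulation_point_stationary H_C1 G_C1 kappa01 sigma01 beta01 rho_gt0
    gamma1_gt0 gamma2_gt0 zd_gen acc).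
- split; first exact: (iterates_superlinear H_C1 G_C1 kappa01 gamma1_gt0 gamma2_gt0
    sol qualif zd_gen acc).
  exact: (iterates_quadratic H_C1 G_C1 kappa01 gamma1_gt0 gamma2_gt0
    sol qualif zd_gen acc).
Qed.
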